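(* Let $U=\{x\in\mathbb{R}^3:x_3>0\}$ and let $f\in C_0^{\infty}(B_{\epsilon_1,\epsilon_2}\cap U)$ for some $0<\epsilon_1<\epsilon_2<1$. Then the spindle interior transform $\mathcal{I}f(r,\alpha,\beta)$ known for all $r\in[0,\infty)$ and for all $(\alpha,\beta)\in S^2$ determines $f$ uniquely for $0<|x|<1$. That is, if $f_1,f_2\in C_0^{\infty}(B_{\epsilon_1,\epsilon_2}\cap U)$ satisfy $\mathcal{I}f_1=\mathcal{I}f_2$ on $[0,\infty)\times S^2$, then $f_1(x)=f_2(x)$ for all $0<|x|<1$.
   Context: Hollow balls: $B_{a,b}=\{x\in\mathbb{R}^3: a<|x|<b\}$. $C_0^\infty(\Omega)$ denotes smooth real-valued functions with compact support in $\Omega$, extended by zero to $\mathbb{R}^3$. Polar form: $F(\rho,\theta,\varphi)=f(\rho\sin\varphi\cos\theta,\rho\sin\varphi\sin\theta,\rho\cos\varphi)$, with $\theta\in[0,2\pi]$ the azimuth and $\varphi\in[0,\pi]$ the colatitude. Rotations: $h=U(\alpha)V(\beta)\in \mathrm{SO}(3)$, where $U(\alpha)$ and $V(\beta)$ (matrices, not to be confused with the half space $U$) are the rotations about the $x_3$- and $x_2$-axis by angles $\alpha\in[0,2\pi]$, $\beta\in[0,\pi]$ respectively, so that $h(0,0,1)^T=(\sin\beta\cos\alpha,\sin\beta\sin\alpha,\cos\beta)^T$. The pair $(\alpha,\beta)$ is identified with this point of $S^2$. The action is $(h\cdot f)(x)=f(hx)$, and $h\cdot F$ is the polar form of $h\cdot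 f$. Spindle interior transform: for $r\ge0$ and $(\alpha,\beta)\in S^2$, $$\mathcal{I}f(r,\alpha,\beta)=\int_{0}^{2\pi}\int_{0}^{\pi}\int_{0}^{\sqrt{r^2\sin^2\varphi+1}-r\sin\varphi}\rho^2\sin\varphi\,(h\cdot F)(\rho,\theta,\varphi)\,\mathrm{d}\rho\,\mathrm{d}\varphi\,\mathrm{d}\theta,\qquad h=U(\alpha)V(\beta).$$ *)

(* Defs.v *)
From HB Require Import structures.
From mathcomp Require Import all_boot all_order all_algebra.
From mathcomp Require Import all_classical all_reals all_analysis.

Set Implicit Arguments.
Unset Strict Implicit.
Unset Printing Implicit Defensive.

Import Order.TTheory GRing.Theory Num.Theory.
Import numFieldNormedType.Exports.

Local Open Scope classical_set_scope.
Local Open Scope ring_scope.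

(* Points of R^3 are column vectors 'cV[R]_3, with
   coordinates x_1, x_2, x_3 at the indices 0, 1, 2 = ord_max of 'I_3. *)

Section Spindle.
Variable R : realType.
Implicit Types (f : 'cV[R]_3 -> R) (x : 'cV[R]_3).

Definition vec3 (a b c : R) : 'cV[R]_3 := \col_(i < 3) [:: a; b; c]`_i.

(* The library norm of 'cV[R]_3 is the sup norm, hence this definition. *)
Definition enorm x : R := Num.sqrt (\sum_(i < 3) x i 0 ^+ 2).

Definition hollow_ball (a b : R) : set 'cV[R]_3 := [set x | a < enorm x < b].

Definition half_space : set 'cV[R]_3 := [set x | 0 < x ord_max 0].

Definition partial (i : 'I_3) f : 'cV[R]_3 -> R := 'D_(delta_mx i 0) f.

(* 'D_v f is a total operator, so derivability is required at every order. *)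
Definition smooth f : Prop := forall s : seq 'I_3,
  let g := foldr partial f s in
  continuous g /\ forall (i : 'I_3) x, derivable g x (delta_mx i 0).

Definition support_closure f : set 'cV[R]_3 := closure [set x | f x != 0].

(* C_0^oo(Omega) for Omega open, with functions extended by zero to R^3. *)
Definition C0infty (Omega : set 'cV[R]_3) f : Prop :=
  [/\ smooth f, compact (support_closure f) & support_closure f `<=` Omega].

(* theta is the azimuth and phi the colatitude. *)
Definition polar_form f (rho theta phi : R) : R :=
  f (vec3 (rho * sin phi * cos theta) (rho * sin phi * sin theta)
          (rho * cos phi)).

Definition mx3 (rows : seq (seq R)) : 'M[R]_3 :=
  \matrix_(i < 3, j < 3) (nth [::] rows i)`_j.

Definition rotU (alpha : R) : 'M[R]_3 :=
  mx3 [:: [:: cos alpha; - sin alpha; 0];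
          [:: sin alpha; cos alpha; 0];
          [:: 0; 0; 1]].

(* The sign of the angle is such that rotU alpha *m rotV beta maps (0, 0, 1)
   to (sin beta * cos alpha, sin beta * sin alpha, cos beta). *)
Definition rotV (beta : R) : 'M[R]_3 :=
  mx3 [:: [:: cos beta; 0; sin beta];
          [:: 0; 1; 0];
          [:: - sin beta; 0; cos beta]].

Definition mxact (h : 'M[R]_3) f : 'cV[R]_3 -> R := fun x => f (h *m x).

Definition spindle_radius (r phi : R) : R :=
  Num.sqrt (r ^+ 2 * sin phi ^+ 2 + 1) - r * sin phi.

(* alpha in [0, 2 pi] and beta in [0, pi] stand for the point
   (sin beta * cos alpha, sin beta * sin alpha, cos beta) of the sphere. *)
Definition spindle_transform f (r alpha beta : R) : R :=
  let hF := polar_form (mxact (rotU alpha *m rotV beta) f) in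
  \int[lebesgue_measure]_(theta in `[0, 2 * pi])
    \int[lebesgue_measure]_(phi in `[0, pi])
      \int[lebesgue_measure]_(rho in `[0, spindle_radius r phi])
        (rho ^+ 2 * sin phi * hF rho theta phi).

End Spindle.

Arguments half_space {R}.

(* Main.v *)
Require Import Defs.
From HB Require Import structures.
From mathcomp Require Import all_boot all_order all_algebra.
From mathcomp Require Import all_classical all_reals all_analysis.
From mathcomp Require Import measurable_realfun.
From mathcomp Require Import ring lra.
Set Implicit Arguments.
Unset Strict Implicit.
Unset Printing Implicit Defensive.
Import Order.TTheory GRing.Theory Num.Theory.
Import numFieldNormedType.Exports.
Local Open Scope classical_set_scope.
Local Open Scope ring_scope.

(** The point [x] of the open unit ball lies in the spindle of parameter [r] and
    axis [w] (a unit vector) when [|x|^2 + 2 r |x cross w| <= 1].  Put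
    [y = x / (1 - |x|^2)] and [t = 1 / (2 r)]: the condition becomes
    [|y cross w| <= t], so in the variable [y] the transform integrates over
    solid cylinders around the line spanned by [w].  Let [F = f1 - f2].

    Moments.  For a fixed axis, the integrals of [F] over all sublevel sets
    [|y cross w| <= t] vanish, hence so do its integrals against all powers
    [|y cross w|^m] ([sublevel_moments], [axial_moments]).  The transform writes
    these integrals in spherical coordinates around the axis; to compare
    different axes one needs that integration over the sphere in spherical
    coordinates is invariant under rotations ([sphere_integral_rot]).  This is
    shown by differentiating in the angle of rotation: the derivative is
    a combination of angular derivatives and integrates to zero by parts.  So
    [F] is orthogonal to [|y cross w|^(2 k)] for every [k] and every vector [w]
    of the space ([transversal_moments]).

    All even polynomials needed.  As a function of [w], the polynomial
    [|y cross w|^(2 k + 2)] has the Laplacian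
    [4 (k + 1)^2 |y|^2 |y cross w|^(2 k)].  Orthogonality for all [w] passes to
    the Laplacian in [w], so [F] is orthogonal to
    [|y|^(2 m) |y cross w|^(2 k)] for all [m], [k] and [w] ([laplacian_step],
    [transversal_moments_sqn], [all_moments]).

    Concentration.  Suppose that [F] is positive at [x0], with image [y0].  The
    polynomial [gap = (|y|^2 - |y0|^2)^2 + |y cross y0|^2] vanishes in the half
    space at [y0] only ([gap_num_separates]), and [F] is orthogonal to all powers
    of [1 - kappa * gap].  For a small [kappa > 0] these powers concentrate at
    [x0], which is absurd ([powers_concentrate], [moments_vanish_nonpos]).  The
    half space matters here: even polynomials do not distinguish [y0] from
    [- y0].  The same argument for [- F] gives [F = 0]. *)

(** * Bounded measurable functions and Fubini's theorem *)

(** On a set of finite measure this class consists of integrable functions, and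
    unlike integrability it is stable under products. *)
Definition bounded_mfun d (T : measurableType d) (R : realType) (D : set T)
    (f : T -> R) : Prop :=
  measurable_fun D f /\ exists M, forall x, D x -> `|f x| <= M.

Section bounded_mfun_algebra.
Context d (T : measurableType d) (R : realType) (D : set T).
Implicit Types f g : T -> R.
Local Notation bm := (@bounded_mfun d T R D).

Lemma bm_cst c : bm (fun=> c).
Proof. by split; [exact: measurable_cst|exists `|c|]. Qed.

Lemma bmD f g : bm f -> bm g -> bm (fun x => f x + g x).
Proof.
move=> [mf [M Mf]] [mg [N Ng]]; split; first exact: measurable_funD.
exists (M + N) => x Dx.
by rewrite (le_trans (ler_normD _ _))// lerD ?Mf ?Ng.
Qed.

Lemma bmN f : bm f -> bm (fun x => - f x).
Proof.
move=> [mf [M Mf]]; split; first exact: measurable_funN.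
by exists M => x Dx; rewrite normrN Mf.
Qed.

Lemma bmB f g : bm f -> bm g -> bm (fun x => f x - g x).
Proof. by move=> bf bg; apply: bmD => //; exact: bmN. Qed.

Lemma bmM f g : bm f -> bm g -> bm (fun x => f x * g x).
Proof.
move=> [mf [M Mf]] [mg [N Ng]]; split; first exact: measurable_funM.
by exists (M * N) => x Dx; rewrite normrM ler_pM ?Mf ?Ng.
Qed.

Lemma bmX f n : bm f -> bm (fun x => f x ^+ n).
Proof.
move=> bf; elim: n => [|n IH]; first exact: bm_cst.
by under eq_fun do rewrite exprS; exact: bmM.
Qed.

Lemma bm_sum I (r : seq I) (F : I -> T -> R) :
  (forall i, bm (F i)) -> bm (fun x => \sum_(i <- r) F i x).
Proof.
move=> bF; elim: r => [|i r IH].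
  by under eq_fun do rewrite big_nil; exact: bm_cst.
by under eq_fun do rewrite big_cons; exact: bmD.
Qed.

Lemma bm_le (u v : T -> R) : measurable D ->
  measurable_fun D u -> measurable_fun D v -> bm (fun x => (u x <= v x)%R%:R).
Proof.
move=> mD mu mv; split.
  rewrite (_ : (fun _ => _) = (fun x => if u x <= v x then 1 else 0)).
    by apply: measurable_fun_if => //; exact: measurable_fun_ler.
  by apply/funext => x; case: ifP.
by exists 1 => x _; case: (u x <= v x); rewrite ?normr1 ?normr0.
Qed.

End bounded_mfun_algebra.

Section bounded_mfun_integral.
Context d (T : measurableType d) (R : realType)
  (mu : {measure set T -> \bar R}) (D : set T).
Hypotheses (mD : measurable D) (muD : (mu D < +oo)%E).
Implicit Types f g : T -> R.
Local Notation bm := (@bounded_mfun d T R D).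

Lemma bm_integrable f : bm f -> mu.-integrable D (EFin \o f).
Proof.
move=> [mf [M Mf]]; apply: measurable_bounded_integrable => //.
exists M; split; first exact: num_real.
by move=> y My x Dx; apply: (le_trans (Mf x Dx)); exact: ltW.
Qed.

Lemma bm_integralD f g : bm f -> bm g ->
  \int[mu]_(x in D) (f x + g x) = \int[mu]_(x in D) f x + \int[mu]_(x in D) g x.
Proof. by move=> bf bg; rewrite RintegralD//; exact: bm_integrable. Qed.

Lemma bm_integralB f g : bm f -> bm g ->
  \int[mu]_(x in D) (f x - g x) = \int[mu]_(x in D) f x - \int[mu]_(x in D) g x.
Proof. by move=> bf bg; rewrite RintegralB//; exact: bm_integrable. Qed.

Lemma bm_integralZ c f : bm f ->
  \int[mu]_(x in D) (c * f x) = c * \int[mu]_(x in D) f x.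
Proof. by move=> bf; rewrite RintegralZl//; exact: bm_integrable. Qed.

Lemma bm_integral_sum I (r : seq I) (F : I -> T -> R) : (forall i, bm (F i)) ->
  \int[mu]_(x in D) (\sum_(i <- r) F i x) =
  \sum_(i <- r) \int[mu]_(x in D) F i x.
Proof.
move=> bF; elim: r => [|i r IH].
  rewrite big_nil; under eq_Rintegral do rewrite big_nil.
  by rewrite Rintegral_cst// mul0r.
rewrite big_cons; under eq_Rintegral do rewrite big_cons.
by rewrite bm_integralD ?IH//; exact: bm_sum.
Qed.

End bounded_mfun_integral.

Section product_sigma_finite.
Context d1 d2 (T1 : measurableType d1) (T2 : measurableType d2) (R : realType).
Variables (m1 : {sigma_finite_measure set T1 -> \bar R})
          (m2 : {sigma_finite_measure set T2 -> \bar R}).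

(** The product measure under a name of its own, which carries its
    sigma-finiteness as a structure, so that it can again be a factor of
    a product. *)
Definition sfprod : set (T1 * T2) -> \bar R := (m1 \x m2)%E.

HB.instance Definition _ := Measure.on sfprod.

Let sfprod_sigma_finite : sigma_finite setT sfprod.
Proof.
have /sigma_finiteP[F [FT ndF Ffin]] := sigma_finiteT m1.
have /sigma_finiteP[G [GT ndG Gfin]] := sigma_finiteT m2.
exists (fun n => F n `*` G n).
  apply/seteqP; split => // -[x y] _.
  have [i _ Fix] : (\bigcup_n F n) x by rewrite -FT.
  have [j _ Gjy] : (\bigcup_n G n) y by rewrite -GT.
  exists (i + j)%N => //; split => /=.
    by move: Fix; apply/subsetPset/ndF; exact: leq_addr.
  by move: Gjy; apply/subsetPset/ndG; exact: leq_addl.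
move=> n; have [mF Fn] := Ffin n; have [mG Gn] := Gfin n.
split; first exact: measurableX.
by rewrite /sfprod product_measure1E// lte_mul_pinfty// ge0_fin_numE.
Qed.

HB.instance Definition _ :=
  Measure_isSigmaFinite.Build _ _ _ sfprod sfprod_sigma_finite.

End product_sigma_finite.

Section bounded_mfun_fubini.
Context d1 d2 (T1 : measurableType d1) (T2 : measurableType d2) (R : realType).
Variables (m1 : {sigma_finite_measure set T1 -> \bar R})
          (m2 : {sigma_finite_measure set T2 -> \bar R}).
Variables (A : set T1) (B : set T2).
Hypotheses (mA : measurable A) (mB : measurable B).
Hypotheses (m1A : (m1 A < +oo)%E) (m2B : (m2 B < +oo)%E).

Lemma product_setX_lty : ((sfprod m1 m2) (A `*` B) < +oo)%E.
Proof.
rewrite -[X in (X < _)%E]/((m1 \x m2)%E (A `*` B)).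
by rewrite product_measure1E// lte_mul_pinfty// ge0_fin_numE.
Qed.

Variable f : T1 * T2 -> R.
Hypothesis bf : bounded_mfun (A `*` B) f.

Lemma bm_sectionl x : A x -> bounded_mfun B (fun y => f (x, y)).
Proof.
move=> Ax; have [mf [M Mf]] := bf; split; last by exists M => y By; exact: Mf.
have /measurable_restrictT mg := mf.
have {}mg := mg (measurableX mA mB).
apply/measurable_restrictT => //.
rewrite (_ : _ \_ _ = fun y => (f \_ (A `*` B)) (x, y)).
  exact: measurable_fun_pair2.
by apply/funext => y; rewrite !patchE in_setX (mem_set Ax).
Qed.

Lemma bm_sectionr y : B y -> bounded_mfun A (fun x => f (x, y)).
Proof.
move=> By; have [mf [M Mf]] := bf; split; last by exists M => x Ax; exact: Mf.
have /measurable_restrictT mg := mf.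
have {}mg := mg (measurableX mA mB).
apply/measurable_restrictT => //.
rewrite (_ : _ \_ _ = fun x => (f \_ (A `*` B)) (x, y)).
  exact: measurable_fun_pair1.
by apply/funext => x; rewrite !patchE in_setX (mem_set By) andbT.
Qed.

Let g := (fun z => ((f \_ (A `*` B)) z)%:E).

Let ig : (sfprod m1 m2).-integrable setT g.
Proof.
have := bm_integrable (measurableX mA mB) product_setX_lty bf.
move/(integrable_mkcond _ (measurableX mA mB)).
by rewrite restrict_EFin.
Qed.

Let gE x : (\int[m2]_y g (x, y))%E =
  (((fun x => \int[m2]_(y in B) f (x, y)) \_ A) x)%:E.
Proof.
rewrite patchE; case: ifPn => xA; last first.
  rewrite integral0_eq// => y _; rewrite /g patchE.
  by rewrite in_setX (negbTE xA).
rewrite /Rintegral fineK; last first.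
  apply: integrable_fin_num => //; apply: bm_integrable => //.
  by apply: bm_sectionl; exact: set_mem.
rewrite [RHS]integral_mkcond; apply: eq_integral => y _.
by rewrite /g !patchE in_setX xA /=; case: ifP.
Qed.

Let gE' y : (\int[m1]_x g (x, y))%E =
  (((fun y => \int[m1]_(x in A) f (x, y)) \_ B) y)%:E.
Proof.
rewrite patchE; case: ifPn => yB; last first.
  rewrite integral0_eq// => x _; rewrite /g patchE.
  by rewrite in_setX (negbTE yB) andbF.
rewrite /Rintegral fineK; last first.
  apply: integrable_fin_num => //; apply: bm_integrable => //.
  by apply: bm_sectionr; exact: set_mem.
rewrite [RHS]integral_mkcond; apply: eq_integral => x _.
by rewrite /g !patchE in_setX yB andbT /=; case: ifP.
Qed.

Lemma bm_fubini1 : \int[m1]_(x in A) \int[m2]_(y in B) f (x, y) =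
  \int[(sfprod m1 m2)]_(z in A `*` B) f z.
Proof.
rewrite [LHS]Rintegral_mkcond [RHS]Rintegral_mkcond; congr fine.
rewrite -[RHS](integral12_prod_meas1 (ig : (m1 \x m2)%E.-integrable setT g)).
apply: eq_integral => x _.
by rewrite -gE.
Qed.

Lemma bm_fubini2 : \int[m2]_(y in B) \int[m1]_(x in A) f (x, y) =
  \int[(sfprod m1 m2)]_(z in A `*` B) f z.
Proof.
rewrite [LHS]Rintegral_mkcond [RHS]Rintegral_mkcond; congr fine.
rewrite -[RHS](integral21_prod_meas1 (ig : (m1 \x m2)%E.-integrable setT g)).
apply: eq_integral => y _.
by rewrite -gE'.
Qed.

Lemma bm_fubini : \int[m1]_(x in A) \int[m2]_(y in B) f (x, y) =
  \int[m2]_(y in B) \int[m1]_(x in A) f (x, y).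
Proof. by rewrite bm_fubini1 bm_fubini2. Qed.

Lemma bm_partial_integral : bounded_mfun A (fun x => \int[m2]_(y in B) f (x, y)).
Proof.
split.
  have := measurable_fubini_F (ig : (m1 \x m2)%E.-integrable setT g).
  rewrite (_ : fubini_F _ _ = EFin \o ((fun x => \int[m2]_(y in B) f (x, y)) \_ A)).
    by move/measurable_EFinP => ?; apply/measurable_restrictT.
  by apply/funext => x; rewrite /fubini_F gE.
have [_ [M Mf]] := bf.
exists (M * fine (m2 B)) => x Ax.
apply: (le_trans (le_normr_Rintegral _ _)) => //.
  exact: bm_integrable (bm_sectionl Ax).
rewrite -Rintegral_cst//; apply: le_Rintegral => //.
- by apply: integrable_norm; apply: bm_integrable (bm_sectionl Ax).
- by apply: (@bm_integrable _ _ _ m2) => //; exact: bm_cst.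
- by move=> y By; exact: Mf.
Qed.

End bounded_mfun_fubini.

Lemma bm_fst d1 d2 (T1 : measurableType d1) (T2 : measurableType d2)
    (R : realType) (A : set T1) (B : set T2) (f : T1 -> R) :
  measurable A -> measurable B -> bounded_mfun A f ->
  bounded_mfun (A `*` B) (fun p => f p.1).
Proof.
move=> mA mB [mf [M fM]]; split; last by exists M => -[x y] [/= Ax _]; exact: fM.
apply: (measurable_comp (F := A) (f := f) (g := fst)) => //.
- by move=> _ [[x y] [/= Ax _] <-].
- exact: measurable_funTS.
Qed.

Lemma bm_snd d1 d2 (T1 : measurableType d1) (T2 : measurableType d2)
    (R : realType) (A : set T1) (B : set T2) (f : T2 -> R) :
  measurable A -> measurable B -> bounded_mfun B f ->
  bounded_mfun (A `*` B) (fun p => f p.2).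
Proof.
move=> mA mB [mf [M fM]]; split; last by exists M => -[x y] [/= _ By]; exact: fM.
apply: (measurable_comp (F := B) (f := f) (g := snd)) => //.
- by move=> _ [[x y] [/= _ By] <-].
- exact: measurable_funTS.
Qed.

(** * Continuous functions of three coordinates *)

Lemma measurable_countable_glue d (T : measurableType d) (R : realType)
    (I : countType) (D : set T) (N : T -> I) (F : I -> T -> R) :
  (forall i, measurable (D `&` [set x | N x = i])) ->
  (forall i, measurable_fun D (F i)) ->
  measurable_fun D (fun x => F (N x) x).
Proof.
move=> mN mF mD Y mY.
rewrite (_ : _ `&` _ = \bigcup_n (if unpickle n is Some i then
   (D `&` [set x | N x = i]) `&` (D `&` F i @^-1` Y) else set0)).
  apply: bigcup_measurable => n _; case: unpickle => [i|]; last exact: measurable0.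
  by apply: measurableI; [exact: mN|exact: mF].
apply/seteqP; split=> [x [Dx /= YFx]|x [n _]].
  by exists (pickle (N x)) => //; rewrite pickleK.
by case: unpickle => [i|]// [[Dx /= Nx] [_ /= YF]]; split => //=; rewrite Nx.
Qed.

Section measurable_continuous_comp.
Context d (T : measurableType d) (R : realType) (D : set T).
Hypothesis mD : measurable D.
Variables (G : 'cV[R]_3 -> R) (u : T -> 'cV[R]_3).
Hypotheses (cG : continuous G)
  (mu : forall i, measurable_fun D (fun x => u x i 0)).

(** Rounding every coordinate down to a multiple of [1 / (n + 1)] gives a vector
    that takes countably many values, so that every function of it is
    measurable; as [n] grows it tends to the original vector. *)
Let grid n i x : int := Num.floor (u x i 0 * n.+1%:R).

Let mgrid n i k : measurable (D `&` [set x | grid n i x = k]).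
Proof.
rewrite (_ : [set _ | _] = (fun x => u x i 0 * n.+1%:R) @^-1`
  [set` `[k%:~R, (k + 1)%:~R[]).
  exact: measurable_funM.
apply/seteqP; split => x /=; rewrite in_itv/= /grid.
  by move=> <-; exact: floor_itv.
by move/floor_def.
Qed.

Lemma measurable_continuous_comp : measurable_fun D (fun x => G (u x)).
Proof.
pose c n (k : int) : R := k%:~R / n.+1%:R.
apply: (@measurable_fun_cvg _ _ _ _ (fun n x =>
  G (\col_i c n (grid n i x)))) => [n|x Dx].
  rewrite (_ : (fun _ => _) = fun x => G (vec3 (c n (grid n 0 x))
     (c n (grid n 1 x)) (c n (grid n ord_max x)))).
    apply: (@measurable_countable_glue _ _ _ _ _ (grid n 0) (fun i x =>
      G (vec3 (c n i) (c n (grid n 1 x)) (c n (grid n ord_max x))))) => // i.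
    apply: (@measurable_countable_glue _ _ _ _ _ (grid n 1) (fun j x =>
      G (vec3 (c n i) (c n j) (c n (grid n ord_max x))))) => // j.
    apply: (@measurable_countable_glue _ _ _ _ _ (grid n ord_max) (fun k x =>
      G (vec3 (c n i) (c n j) (c n k)))) => // k.
  apply/funext => x; congr G; apply/colP => i; rewrite !mxE.
  by case: i => -[|[|[|//]]] /= ?; congr (c n (grid n _ x)); exact: val_inj.
apply: (@cvg_comp _ _ _ _ G _ (nbhs (u x))); last exact: cG.
apply/cvgrPdist_le => e e0; near=> n.
rewrite [leLHS]/Num.Def.normr/= mx_normrE (bigmax_le _ (ltW e0))//= => -[i j] _.
rewrite !mxE (ord1 j) /c /grid.
have n0 : (0 : R) < n.+1%:R by rewrite ltr0n.
have := floor_le (u x i 0 * n.+1%:R); have := floorD1_gt (u x i 0 * n.+1%:R).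
set k := Num.floor _; rewrite intrD => kgt kle.
have ne : n.+1%:R^-1 < e.
  by near: n; exact: (near_infty_natSinv_lt (PosNum e0)).
rewrite -[X in X - _](mulfK (lt0r_neq0 n0)) -mulrBl normrM.
rewrite [X in _ * X]ger0_norm ?invr_ge0 1?ltW//.
apply: le_lt_trans ne.
rewrite ger_pMl ?invr_gt0// ger0_norm ?subr_ge0//; lra.
Unshelve. all: by end_near. Qed.

End measurable_continuous_comp.

Section cV_topology.
Variable R : realType.
Implicit Types (G : 'cV[R]_3 -> R) (x y : 'cV[R]_3).

Lemma cV_norm_le x e : 0 <= e -> (forall i, `|x i 0| <= e) -> `|x| <= e.
Proof.
move=> e0 H; rewrite /Num.Def.normr/= mx_normrE.
by apply: bigmax_le => //= -[i j] _; rewrite (ord1 j).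
Qed.

Lemma cV_coord_norm x i : `|x i 0| <= `|x|.
Proof. by rewrite [leRHS]/Num.Def.normr/= mx_normrE; exact: (le_bigmax _ _ (i, 0)). Qed.

Lemma cV_cvg (T : Type) (F : set_system T) (FF : Filter F) (u : T -> 'cV[R]_3) x :
  (forall i, (fun t => u t i 0) @ F --> x i 0) -> u @ F --> x.
Proof.
move=> H; apply/cvgrPdist_le => e e0.
have K i : \forall t \near F, `|x i 0 - u t i 0| <= e.
  by move: e e0; apply/cvgrPdist_le.
near=> t; apply: cV_norm_le => [|i]; first exact: ltW.
by rewrite !mxE; move: i; near: t; apply: filter_forall.
Unshelve. all: by end_near. Qed.

(** A box is compact; compactness is transported from row vectors. *)
Lemma continuous_bounded_box G M : continuous G ->
  exists C, forall x, (forall i, `|x i 0| <= M) -> `|G x| <= C.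
Proof.
move=> cG.
pose K := [set v : 'rV[R]_3 | forall i, `[(- M), M]%classic (v ord0 i)].
have cK : compact K by exact: (rV_compact (fun=> @segment_compact R (- M) M)).
have /compact_bounded[C [_ CK]] : compact ((G \o trmx) @` K).
  apply: (continuous_compact _ cK); apply: continuous_subspaceT => v.
  apply: continuous_comp; last exact: cG.
  apply: (@cV_cvg _ (nbhs v) _ trmx) => i.
  under eq_fun do rewrite mxE; rewrite mxE; exact: coord_continuous.
exists (C + 1) => x Mx; apply: (CK (C + 1)); first by rewrite ltrDl.
exists x^T; last by rewrite /= trmxK.
by move=> i /=; rewrite mxE in_itv/= -ler_norml; exact: Mx.
Qed.

End cV_topology.

(** * Continuously differentiable functions *)

Section C1.
Variable R : realType.
Implicit Types (G : 'cV[R]_3 -> R) (g : 'I_3 -> 'cV[R]_3 -> R) (x y : 'cV[R]_3).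

Local Notation e_ i := (delta_mx i 0 : 'cV[R]_3).

(** Continuous partial derivatives are all that the chain rule along curves
    requires; the gradient [g] is kept explicit because integrals of it occur. *)
Definition C1 G g := continuous G /\
  forall i, continuous (g i) /\ forall x, is_derive x (e_ i) G (g i x).

Variables (G : 'cV[R]_3 -> R) (g : 'I_3 -> 'cV[R]_3 -> R).
Hypothesis C1G : C1 G g.

Let is_derive_line x i (s : R) :
  is_derive s (1 : R) (fun s => G (x + s *: e_ i)) (g i (x + s *: e_ i)).
Proof.
have [_ /(_ i)[_ /(_ (x + s *: e_ i)) [dG <-]]] := C1G.
have E : (fun h : R => h^-1 *: (((fun s => G (x + s *: e_ i)) \o shift s)
    (h *: (1 : R)) - G (x + s *: e_ i))) =
  (fun h => h^-1 *: ((G \o shift (x + s *: e_ i)) (h *: e_ i)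
    - G (x + s *: e_ i))).
  by apply/funext => h; rewrite /= -[h%:A]/(h * 1) mulr1 scalerDl addrCA.
by apply: DeriveDef; rewrite /derivable /derive E.
Qed.

Let mvt_axis i x h : exists2 s, `|s| <= `|h| &
  G (x + h *: e_ i) - G x = h * g i (x + s *: e_ i).
Proof.
have cont A : {within A, continuous (fun s => G (x + s *: e_ i))}.
  apply: continuous_subspaceT => s.
  apply/differentiable_continuous/derivable1_diffP.
  exact: (@ex_derive _ _ _ _ _ _ _ (is_derive_line x i s)).
have [h0|h0] := leP 0 h.
  have [c] := MVT_segment h0 (fun s _ => is_derive_line x i s) (cont _).
  rewrite in_itv/= scale0r addr0 subr0 => /andP[c0 ch] ->.
  by exists c; rewrite ?ger0_norm// mulrC.
have [c] := MVT_segment (ltW h0) (fun s _ => is_derive_line x i s) (cont _).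
rewrite in_itv/= scale0r addr0 sub0r => /andP[c0 ch] E.
exists c; first by rewrite !ler0_norm ?lerN2// ltW.
by rewrite -opprB E mulrN opprK mulrC.
Qed.

(** Move from [x] to [y] along one axis at a time and apply the mean value
    theorem on each of the three segments. *)
Lemma C1_mvt x y : exists2 xi : 'I_3 -> 'cV[R]_3,
  (forall i, `|xi i - x| <= `|y - x|) &
  G y - G x = \sum_i (y i 0 - x i 0) * g i (xi i).
Proof.
pose h i := y i 0 - x i 0.
have hn i : `|h i| <= `|y - x|.
  by have := cV_coord_norm (y - x) i; rewrite !mxE.
have [s0 s0h E0] := mvt_axis 0 x (h 0).
have [s1 s1h E1] := mvt_axis 1 (x + h 0 *: e_ 0) (h 1).
have [s2 s2h E2] := mvt_axis ord_max (x + h 0 *: e_ 0 + h 1 *: e_ 1) (h ord_max).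
exists (fun i => x + [:: s0 *: e_ 0; h 0 *: e_ 0 + s1 *: e_ 1;
  h 0 *: e_ 0 + h 1 *: e_ 1 + s2 *: e_ ord_max]`_i).
  move=> i; rewrite [X in `|X|]addrC addKr.
  apply: cV_norm_le => // j.
  have := hn 0; have := hn 1; have := normr_ge0 (y - x).
  have := le_trans s0h (hn _); have := le_trans s1h (hn _); have := le_trans s2h (hn _).
  move=> ? ? ? ? ? ?.
  by case: i => -[|[|[|//]]] i; case: j => -[|[|[|//]]] j;
     rewrite /= !mxE /= ?(mulr0, mulr1, addr0, add0r) ?normr0.
rewrite !big_ord_recl big_ord0 /= addr0.
have Ey : y = x + h 0 *: e_ 0 + h 1 *: e_ 1 + h ord_max *: e_ ord_max.
  apply/colP => j; case: j => -[|[|[|//]]] j;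
     rewrite /= !mxE /= ?(mulr0, mulr1, addr0, add0r) /h;
     apply/eqP; rewrite addrC -subr_eq; apply/eqP;
     congr (y _ _ - x _ _); exact: val_inj.
rewrite [in G y]Ey.
have -> : lift ord0 (lift ord0 ord0) = ord_max :> 'I_3 by exact: val_inj.
have -> : lift ord0 ord0 = 1 :> 'I_3 by exact: val_inj.
rewrite -/(h 0) -/(h 1) -/(h ord_max) !addrA -E0 -E1 -E2; ring.
Qed.

(** In the expansion of the difference quotient by [C1_mvt], the intermediate
    points [xi] tend to [u t], where the partial derivatives are continuous. *)
Lemma C1_chain (u : R -> 'cV[R]_3) (u' : 'cV[R]_3) (t : R) :
  (forall i, is_derive t (1 : R) (fun s => u s i 0) (u' i 0)) ->
  is_derive t (1 : R) (G \o u) (\sum_i u' i 0 * g i (u t)).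
Proof.
move=> du.
have [xi xiP E] : exists2 xi : 'I_3 -> R -> 'cV[R]_3,
    (forall i s, `|xi i s - u t| <= `|u s - u t|) &
    forall s, G (u s) - G (u t) = \sum_i (u s i 0 - u t i 0) * g i (xi i s).
  have /choice[xi H] : forall s, exists xi : 'I_3 -> 'cV[R]_3,
     (forall i, `|xi i - u t| <= `|u s - u t|) /\
     G (u s) - G (u t) = \sum_i (u s i 0 - u t i 0) * g i (xi i).
    by move=> s; have [xi ? ?] := C1_mvt (u t) (u s); exists xi.
  by exists (fun i s => xi s i) => [i s|s]; have [] := H s.
have cu : {for t, continuous u}.
  apply: cV_cvg => i; apply/differentiable_continuous/derivable1_diffP.
  exact: (@ex_derive _ _ _ _ _ _ _ (du i)).
have cvt : h *: 1 + t @[h --> 0^'] --> t.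
  have {2}-> : t = 0 *: 1 + t by rewrite scale0r add0r.
  apply: cvgD; last exact: cvg_cst.
  apply: cvgZr_tmp; exact: nbhs_dnbhs.
have cut : u (h *: 1 + t) @[h --> 0^'] --> u t by exact: cvg_comp cvt cu.
have cxi i : xi i (h *: 1 + t) @[h --> 0^'] --> u t.
  apply/cvgrPdist_le => e e0; near=> h.
  rewrite distrC (le_trans (xiP _ _))// distrC.
  by near: h; move: e e0; apply/cvgrPdist_le.
have L : h^-1 *: ((G \o u) (h *: 1 + t) - (G \o u) t) @[h --> 0^'] -->
    \sum_i u' i 0 * g i (u t).
  under eq_fun do rewrite /= E scaler_sumr.
  have K i : h^-1 *: ((u (h *: 1 + t) i 0 - u t i 0) * g i (xi i (h *: 1 + t)))
      @[h --> 0^'] --> u' i 0 * g i (u t).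
    under eq_fun do rewrite scalerAl.
    apply: cvgM.
      have [dui dE] := du i; rewrite -dE; exact: dui.
    have [_ /(_ i)[cg _]] := C1G.
    exact: (@cvg_comp _ _ _ _ (g i) _ _ _ (cxi i) (cg _)).
  rewrite !big_ord_recl big_ord0.
  under eq_fun do rewrite !big_ord_recl big_ord0.
  by repeat (apply: cvgD => //); exact: cvg_cst.
apply: DeriveDef; first by apply/cvg_ex; exists (\sum_i u' i 0 * g i (u t)).
by apply/cvg_lim.
Unshelve. all: by end_near. Qed.

End C1.

Section C1_algebra.
Variable R : realType.
Implicit Types (G H : 'cV[R]_3 -> R) (g h : 'I_3 -> 'cV[R]_3 -> R).

Lemma C1_cst c : C1 (fun=> c : R) (fun _ _ => 0).
Proof.
split; first exact: cst_continuous.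
by move=> i; split=> x; [exact: (@cst_continuous _ _ (0:R))|exact: is_derive_cst].
Qed.

Lemma C1_coord j : C1 (fun x : 'cV[R]_3 => x j 0) (fun i _ => (i == j)%:R).
Proof.
split; first exact: coord_continuous.
move=> i; split => x; first exact: (@cst_continuous _ _ ((i == j)%:R : R)).
have E : (fun h : R => h^-1 *: (((fun x : 'cV[R]_3 => x j 0) \o shift x)
    (h *: delta_mx i 0) - x j 0)) @ 0^' --> ((i == j)%:R : R).
  have : cst ((i == j)%:R : R) @ (0 : R)^' --> ((i == j)%:R : R) by exact: cvg_cst.
  apply: cvg_trans; apply: near_eq_cvg; near=> h.
  have h0 : h != 0 by near: h; exact: nbhs_dnbhs_neq.
  rewrite /= !mxE addrK eqxx andbT /cst eq_sym.
  by rewrite [RHS]mulKf.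
apply: DeriveDef; first by apply/cvg_ex; exists (i == j)%:R.
exact/cvg_lim.
Unshelve. all: by end_near. Qed.

Lemma C1D G H g h : C1 G g -> C1 H h ->
  C1 (fun x => G x + H x) (fun i x => g i x + h i x).
Proof.
move=> [cG dG] [cH dH]; split; first by move=> x; exact: (cvgD (cG x) (cH x)).
move=> i; have [cg {}dG] := dG i; have [ch {}dH] := dH i.
split=> x; first by exact: (cvgD (cg x) (ch x)).
exact: (is_deriveD (dG x) (dH x)).
Qed.

Lemma C1M G H g h : C1 G g -> C1 H h ->
  C1 (fun x => G x * H x) (fun i x => G x * h i x + H x * g i x).
Proof.
move=> [cG dG] [cH dH]; split; first by move=> x; exact: (cvgM (cG x) (cH x)).
move=> i; have [cg {}dG] := dG i; have [ch {}dH] := dH i.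
split=> x; last exact: (is_deriveM (dG x) (dH x)).
exact: (cvgD (cvgM (cG x) (ch x)) (cvgM (cH x) (cg x))).
Qed.

Definition continuously_differentiable G := exists g, C1 G g.

Lemma cdiff_cst c : continuously_differentiable (fun=> c).
Proof. by eexists; exact: C1_cst. Qed.

Lemma cdiff_coord j : continuously_differentiable (fun x => x j 0).
Proof. by eexists; exact: C1_coord. Qed.

Lemma cdiffD G H : continuously_differentiable G ->
  continuously_differentiable H -> continuously_differentiable (fun x => G x + H x).
Proof. by move=> [g Gg] [h Hh]; eexists; exact: C1D Gg Hh. Qed.

Lemma cdiffM G H : continuously_differentiable G ->
  continuously_differentiable H -> continuously_differentiable (fun x => G x * H x).
Proof. by move=> [g Gg] [h Hh]; eexists; exact: C1M Gg Hh. Qed.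

Lemma cdiffX G n : continuously_differentiable G ->
  continuously_differentiable (fun x => G x ^+ n).
Proof.
move=> dG; elim: n => [|n IH]; first exact: cdiff_cst.
by under eq_fun do rewrite exprS; exact: cdiffM.
Qed.

Lemma cdiff_sum I (r : seq I) (F : I -> 'cV[R]_3 -> R) :
  (forall i, continuously_differentiable (F i)) ->
  continuously_differentiable (fun x => \sum_(i <- r) F i x).
Proof.
move=> dF; elim: r => [|i r IH].
  by under eq_fun do rewrite big_nil; exact: cdiff_cst.
by under eq_fun do rewrite big_cons; exact: cdiffD.
Qed.

Lemma cdiff_continuous (G : 'cV[R]_3 -> R) :
  continuously_differentiable G -> continuous G.
Proof. by case=> g []. Qed.

Lemma smooth_cdiff G : smooth G -> continuously_differentiable G.
Proof.
move=> sG; have [cG dG] := sG [::].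
exists (fun i => partial i G); split=> // i; have [cg _] := sG [:: i].
by split=> // x; exact: derivableP.
Qed.

End C1_algebra.

Section one_variable.
Variable R : realType.

Lemma integral_derivative (F f : R -> R) (a b : R) : a < b ->
  (forall s, is_derive s (1 : R) F (f s)) -> continuous f ->
  \int[lebesgue_measure]_(s in `[a, b]) f s = F b - F a.
Proof.
move=> ab dF cf.
have cF : continuous F.
  move=> s; apply/differentiable_continuous/derivable1_diffP.
  exact: (@ex_derive _ _ _ _ _ _ _ (dF s)).
rewrite /Rintegral (@continuous_FTC2 _ f F)//.
- exact: continuous_subspaceT.
- split=> [s _||].
  + exact: (@ex_derive _ _ _ _ _ _ _ (dF s)).
  + exact/cvg_at_right_filter/cF.
  + exact/cvg_at_left_filter/cF.
- by move=> s _; rewrite derive1E; have [_ ->] := dF s.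
Qed.

(** Every coordinate of a point moved by one of the angles has the form
    [A sin s + B cos s + C] in that angle. *)
Lemma is_derive_trig (A B C s : R) :
  is_derive s (1 : R) (fun s => A * sin s + B * cos s + C) (A * cos s - B * sin s).
Proof.
apply: is_derive_eq.
rewrite /GRing.scale/=; ring.
Qed.

Lemma is_derive_trig_eq (f : R -> R) (A B C d s : R) :
  (forall s, f s = A * sin s + B * cos s + C) ->
  d = A * cos s - B * sin s -> is_derive s (1 : R) f d.
Proof. by move=> /funext -> ->; exact: is_derive_trig. Qed.

End one_variable.

Section bm_continuous.
Context d (T : measurableType d) (R : realType) (D : set T).
Hypothesis mD : measurable D.

Lemma bm_continuous_comp (G : 'cV[R]_3 -> R) (u : T -> 'cV[R]_3) :
  continuous G -> (forall i, bounded_mfun D (fun x => u x i 0)) ->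
  bounded_mfun D (fun x => G (u x)).
Proof.
move=> cG bu; split.
  by apply: measurable_continuous_comp => // i; have [] := bu i.
have /choice[M uM] : forall i, exists M, forall x, D x -> `|u x i 0| <= M.
  by move=> i; have [] := bu i.
have [C GC] := continuous_bounded_box (\sum_i `|M i|) cG.
exists C => x Dx; apply: GC => i.
rewrite (le_trans (uM i _ Dx))// (le_trans (ler_norm _))//.
by rewrite (bigD1 i)//= lerDl sumr_ge0.
Qed.

Lemma bm_comp_bounded (h : R -> R) (f : T -> R) C : continuous h ->
  (forall s, `|h s| <= C) -> measurable_fun D f ->
  bounded_mfun D (fun x => h (f x)).
Proof.
move=> ch hC mf; split; last by exists C => x _; exact: hC.
by apply: measurableT_comp => //; exact: continuous_measurable_fun.
Qed.

Lemma bm_sin (f : T -> R) : measurable_fun D f -> bounded_mfun D (fun x => sin (f x)).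
Proof. by apply: bm_comp_bounded; [exact: continuous_sin|exact: sin_max]. Qed.

Lemma bm_cos (f : T -> R) : measurable_fun D f -> bounded_mfun D (fun x => cos (f x)).
Proof. by apply: bm_comp_bounded; [exact: continuous_cos|exact: cos_max]. Qed.

End bm_continuous.

(** * Invariance of spherical integrals under rotations *)

Section flow.
Context d (T : measurableType d) (R : realType)
  (mu : {measure set T -> \bar R}) (D : set T).
Hypotheses (mD : measurable D) (muD : (mu D < +oo)%E).

(** Differentiation under the integral sign: the hypothesis says that the
    derivative in [b] vanishes for all [b]. *)
Lemma flow_integral_cst (w : T -> R) G g (W W' : R -> T -> 'cV[R]_3) M :
  C1 G g -> bounded_mfun D w ->
  (forall b i, bounded_mfun D (fun z => W b z i 0)) ->
  (forall b z i, D z -> `|W b z i 0| <= M) ->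
  (forall b z i, D z -> `|W' b z i 0| <= M) ->
  (forall b z i, is_derive b (1 : R) (fun b => W b z i 0) (W' b z i 0)) ->
  (forall b, \int[mu]_(z in D) (w z * \sum_i W' b z i 0 * g i (W b z)) = 0) ->
  forall a b, \int[mu]_(z in D) (w z * G (W a z)) =
              \int[mu]_(z in D) (w z * G (W b z)).
Proof.
move=> C1G bw bW WM W'M dW I0.
pose f b z := w z * G (W b z).
have df b z : is_derive b (1 : R) (f^~ z) (w z * \sum_i W' b z i 0 * g i (W b z)).
  exact: (is_deriveZ (w z) (C1_chain C1G (dW b z))).
have [wm [N wN]] := bw.
have /choice[C gC] : forall i, exists C, forall x : 'cV[R]_3,
    (forall i, `|x i 0| <= M) -> `|g i x| <= C.
  by move=> i; apply: continuous_bounded_box; have [_ /(_ i)[]] := C1G.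
pose K := `|N| * \sum_i (`|M| * `|C i|).
have fK b z : D z -> `|w z * \sum_i W' b z i 0 * g i (W b z)| <= K.
  move=> Dz; rewrite normrM ler_pM//; first exact: le_trans (wN _ Dz) (ler_norm _).
  rewrite (le_trans (ler_norm_sum _ _ _))// ler_sum// => i _.
  rewrite normrM ler_pM//; first exact: le_trans (W'M _ _ _ Dz) (ler_norm _).
  by rewrite (le_trans _ (ler_norm _))// gC// => j; exact: WM.
have bf b : bounded_mfun D (f b).
  apply: bmM => //; apply: bm_continuous_comp => //.
  by have [] := C1G.
pose F b := \int[mu]_(z in D) f b z.
suff dF a : is_derive a (1 : R) F 0.
  by move=> a b; exact: (@is_derive_0_is_cst R F a b dF).
have Ia : `]a - 1, a + 1[%classic a by rewrite /= in_itv/= ltrDl gtrDl ltrN10 ltr01.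
have int_f b : `]a - 1, a + 1[%classic b -> mu.-integrable D (EFin \o f b).
  by move=> _; exact: bm_integrable.
have der_f b z : `]a - 1, a + 1[%classic b -> D z -> derivable (f^~ z) b 1.
  by move=> _ _; exact: (@ex_derive _ _ _ _ _ _ _ (df b z)).
have K0 : 0 <= K by rewrite mulr_ge0// sumr_ge0// => i _; rewrite mulr_ge0.
have intK : mu.-integrable D (EFin \o cst K) by apply: bm_integrable => //; exact: bm_cst.
have ubK b z : `]a - 1, a + 1[%classic b -> D z -> `|partial1of2 f b z| <= cst K z.
  move=> _ Dz; rewrite partial1of2E; have [_ ->] := df b z; exact: fK.
have dF := derivable_under_integral mD Ia int_f der_f (fun=> K0) intK ubK.
have F0 := differentiation_under_integral mD Ia int_f der_f (fun=> K0) intK ubK.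
apply: DeriveDef => //.
rewrite -derive1E F0 -[RHS](I0 a); apply: eq_Rintegral => z _.
by rewrite partial1of2E; have [_ ->] := df a z.
Qed.

End flow.

Section linear_combination.
Variable R : realType.
Implicit Types (B : 'M[R]_3) (a b c : R).

(** The product of [B] with a vector, written so that membership of its
    coordinates in [bounded_mfun] follows from the shape of the expression. *)
Definition lin3 B a b c : 'cV[R]_3 :=
  \col_i (B i 0 * a + B i 1 * b + B i ord_max * c).

Lemma mul_vec3 B a b c : B *m vec3 a b c = lin3 B a b c.
Proof.
apply/colP => i; rewrite !mxE !big_ord_recl big_ord0 !mxE /= addr0 !addrA.
by congr (_ * _ + B i _ * _ + B i _ * _); exact: val_inj.
Qed.

Lemma vec3P (x : 'cV[R]_3) : x = vec3 (x 0 0) (x 1 0) (x ord_max 0).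
Proof.
by apply/colP => i; rewrite mxE; case: i => -[|[|[|//]]] i /=;
  congr (x _ _); exact: val_inj.
Qed.

Lemma rotU_vec3 t a b c :
  rotU t *m vec3 a b c = vec3 (cos t * a - sin t * b) (sin t * a + cos t * b) c.
Proof.
rewrite mul_vec3; apply/colP => i; rewrite !mxE.
by case: i => -[|[|[|//]]] i /=; ring.
Qed.

Lemma rotV_vec3 t a b c :
  rotV t *m vec3 a b c = vec3 (cos t * a + sin t * c) b (cos t * c - sin t * a).
Proof.
rewrite mul_vec3; apply/colP => i; rewrite !mxE.
by case: i => -[|[|[|//]]] i /=; ring.
Qed.

Lemma lin3_le B a b c M i : `|a| <= M -> `|b| <= M -> `|c| <= M ->
  `|lin3 B a b c i 0| <= `|B| * M *+ 3.
Proof.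
have Bij j : `|B i j| <= `|B|.
  by rewrite [leRHS]/Num.Def.normr/= mx_normrE; exact: (le_bigmax _ _ (i, j)).
move=> aM bM cM; rewrite mxE (le_trans (ler_normD _ _))// mulrSr lerD//.
  rewrite (le_trans (ler_normD _ _))// mulr2n lerD// normrM ler_pM//.
by rewrite normrM ler_pM.
Qed.

Lemma bm_lin3 d (T : measurableType d) (D : set T) B (a b c : T -> R) i :
  bounded_mfun D a -> bounded_mfun D b -> bounded_mfun D c ->
  bounded_mfun D (fun z => lin3 B (a z) (b z) (c z) i 0).
Proof.
move=> ba bb bc; under eq_fun do rewrite mxE.
by repeat apply: bmD; apply: bmM => //; exact: bm_cst.
Qed.

End linear_combination.

Section parts.
Context (R : realType) (G : 'cV[R]_3 -> R) (g : 'I_3 -> 'cV[R]_3 -> R).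
Hypothesis C1G : C1 G g.

(** By the chain rule the sum of the two integrands is the derivative of
    [h * (G \o u)], whose values at the end points agree. *)
Lemma curve_integration_by_parts (u u' : R -> 'cV[R]_3) (h h' : R -> R) (a b : R) :
  a < b -> (forall s i, is_derive s (1 : R) (fun s => u s i 0) (u' s i 0)) ->
  (forall i, continuous (fun s => u' s i 0)) ->
  (forall s, is_derive s (1 : R) h (h' s)) -> continuous h' ->
  h a * G (u a) = h b * G (u b) ->
  \int[lebesgue_measure]_(s in `[a, b]) (h s * \sum_i u' s i 0 * g i (u s)) =
  - \int[lebesgue_measure]_(s in `[a, b]) (h' s * G (u s)).
Proof.
move=> ab du cu' dh ch' hab; have [cG dG] := C1G.
have derc (f f' : R -> R) : (forall s, is_derive s (1 : R) f (f' s)) -> continuous f.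
  move=> df s; apply/differentiable_continuous/derivable1_diffP.
  exact: (@ex_derive _ _ _ _ _ _ _ (df s)).
have cu : continuous u.
  by move=> s; apply: cV_cvg => i; exact: (derc _ _ (fun s => du s i)).
have cGu : continuous (G \o u) by move=> s; exact: continuous_comp (cu s) (cG _).
have cgu i : continuous (g i \o u).
  by move=> s; apply: continuous_comp (cu s) _; have [cg _] := dG i; exact: cg.
have ch : continuous h := derc _ _ dh.
pose k s := \sum_i u' s i 0 * g i (u s).
have ck : continuous k.
  move=> s; rewrite /k /=.
  under [X in continuous_at _ X]eq_fun do rewrite !big_ord_recl big_ord0.
  by repeat (apply: cvgD; first exact: (cvgM (cu' _ s) (cgu _ s))); exact: cvg_cst.
have I f : continuous f -> lebesgue_measure.-integrable `[a, b] (EFin \o (f : R -> R)).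
  move=> cf; apply: continuous_compact_integrable; first exact: segment_compact.
  exact: continuous_subspaceT.
have c1 : continuous (fun s => h s * k s) by move=> s; exact: (cvgM (ch s) (ck s)).
have c2 : continuous (fun s => h' s * G (u s)).
  by move=> s; exact: (cvgM (ch' s) (cGu s)).
have dF s : is_derive s (1 : R) (fun s => h s * G (u s))
    (h s * k s + h' s * G (u s)).
  apply: is_derive_eq; first exact: (is_deriveM (dh s) (C1_chain C1G (du s))).
  by rewrite /GRing.scale/= (mulrC (G _)).
have cF : continuous (fun s => h s * k s + h' s * G (u s)).
  by move=> s; exact: (cvgD (c1 s) (c2 s)).
apply/eqP; rewrite -addr_eq0 -RintegralD//; try exact: I.
by rewrite (integral_derivative ab dF cF) hab subrr.
Qed.

End parts.

Section rotation_invariance.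
Variable R : realType.
Local Notation lam := (@lebesgue_measure R).
Local Notation Theta := `[0, 2 * (pi : R)]%classic.
Local Notation Phi := `[0, (pi : R)]%classic.

Lemma itv_lty (a b : R) : (lam `[a, b] < +oo)%E.
Proof. by rewrite lebesgue_measure_itv; case: ifP; rewrite ltry. Qed.

Definition angles : set (R * R) := Theta `*` Phi.
Local Notation angle_measure := (sfprod lam lam).

Lemma measurable_angles : measurable angles.
Proof. exact: measurableX. Qed.

Lemma angles_lty : (angle_measure angles < +oo)%E.
Proof. by apply: product_setX_lty => //; exact: itv_lty. Qed.

Definition spherical (rho theta phi : R) : 'cV[R]_3 :=
  vec3 (rho * sin phi * cos theta) (rho * sin phi * sin theta) (rho * cos phi).

Local Notation bm := (bounded_mfun angles).

Lemma bm_sin_azimuth : bm (fun z => sin z.1).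
Proof. by apply: bm_sin; exact: measurable_funTS. Qed.
Lemma bm_cos_azimuth : bm (fun z => cos z.1).
Proof. by apply: bm_cos; exact: measurable_funTS. Qed.
Lemma bm_sin_colatitude : bm (fun z => sin z.2).
Proof. by apply: bm_sin; exact: measurable_funTS. Qed.
Lemma bm_cos_colatitude : bm (fun z => cos z.2).
Proof. by apply: bm_cos; exact: measurable_funTS. Qed.

Ltac bm_angles := repeat first
  [ exact: bm_sin_azimuth | exact: bm_cos_azimuth | exact: bm_sin_colatitude
  | exact: bm_cos_colatitude | exact: bm_cst
  | apply: bm_lin3 | apply: bmB | apply: bmD | apply: bmN | apply: bmM ].

Lemma continuous_trig (A C : R) (f : R -> R) :
  (forall s, f s = A * cos s - C * sin s) -> continuous f.
Proof.
move=> /funext -> s.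
by apply: cvgB; apply: cvgM; [exact: cvg_cst|exact: continuous_cos
  |exact: cvg_cst|exact: continuous_sin].
Qed.

Let pi0 : (0 : R) < pi. Proof. exact: pi_gt0. Qed.
Let pi20 : (0 : R) < 2 * pi. Proof. by rewrite mulr_gt0// ltr0n. Qed.
Let s2pi : sin (2 * pi : R) = 0. Proof. by rewrite mulr_natl sin2pi. Qed.
Let c2pi : cos (2 * pi : R) = 1. Proof. by rewrite mulr_natl cos2pi. Qed.

Variables (G : 'cV[R]_3 -> R) (g : 'I_3 -> 'cV[R]_3 -> R).
Hypothesis C1G : C1 G g.

Section tilt.
Variables (B : 'M[R]_3) (rho : R).

(** [W b z] is the point with angles [z] turned by [b] and then moved by [B];
    [W'], [Wphi] and [Wth] are its derivatives in [b], in the colatitude and in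
    the azimuth. *)
Let mix (b x y z : R) := lin3 B (cos b * x + sin b * z) y (cos b * z - sin b * x).
Let W b (z : R * R) := mix b (rho * sin z.2 * cos z.1) (rho * sin z.2 * sin z.1)
  (rho * cos z.2).
Let W' b (z : R * R) := lin3 B
  (- sin b * (rho * sin z.2 * cos z.1) + cos b * (rho * cos z.2)) 0
  (- sin b * (rho * cos z.2) - cos b * (rho * sin z.2 * cos z.1)).
Let Wphi b (z : R * R) := mix b (rho * cos z.2 * cos z.1) (rho * cos z.2 * sin z.1)
  (- rho * sin z.2).
Let Wth b (z : R * R) := mix b (- rho * sin z.2 * sin z.1) (rho * sin z.2 * cos z.1) 0.

Let grad b z (v : R -> R * R -> 'cV[R]_3) := \sum_i v b z i 0 * g i (W b z).

Let bW b i : bm (fun z => W b z i 0).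
Proof. rewrite /W /mix; bm_angles. Qed.
Let bWphi b i : bm (fun z => Wphi b z i 0).
Proof. rewrite /Wphi /mix; bm_angles. Qed.
Let bWth b i : bm (fun z => Wth b z i 0).
Proof. rewrite /Wth /mix; bm_angles. Qed.

Let bgrad b (v : R -> R * R -> 'cV[R]_3) :
  (forall i, bm (fun z => v b z i 0)) -> bm (fun z => grad b z v).
Proof.
move=> bv; apply: bm_sum => i; apply: bmM => //.
apply: bm_continuous_comp => //; first exact: measurable_angles.
by have [_ /(_ i)[]] := C1G.
Qed.

Let bGW b : bm (fun z => G (W b z)).
Proof.
apply: bm_continuous_comp => //; first exact: measurable_angles.
by have [] := C1G.
Qed.

(** The velocity of the rotation about the second axis is
    [cos theta d/dphi - cot phi sin theta d/dtheta]; the density [sin phi] of the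
    sphere clears the denominator. *)
Let gradE b z : sin z.2 * grad b z W' =
  cos z.1 * (sin z.2 * grad b z Wphi) - cos z.2 * (sin z.1 * grad b z Wth).
Proof.
rewrite !mulr_sumr -sumrB; apply: eq_bigr => i _.
rewrite ![in RHS]mulrA -mulrBl mulrA; congr (_ * _).
rewrite /W' /Wphi /Wth /mix !mxE.
have := cos2sin2 z.1; rewrite !expr2 => E.
ring: E.
Qed.

(** The coefficients of sine and cosine in the coordinates of [W], as a function
    of the azimuth and as a function of the colatitude. *)
Let Ath (p : R) i := rho * sin p * B i 1.
Let Cth b (p : R) i := rho * sin p * (B i 0 * cos b - B i ord_max * sin b).
Let Aphi b (t : R) i :=
  rho * (B i 0 * cos b * cos t + B i 1 * sin t - B i ord_max * sin b * cos t).
Let Cphi b i := rho * (B i 0 * sin b + B i ord_max * cos b).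

Let by_parts_phi b t :
  \int[lam]_(p in Phi) (sin p * grad b (t, p) Wphi) =
  - \int[lam]_(p in Phi) (cos p * G (W b (t, p))).
Proof.
have E s i : Wphi b (t, s) i 0 = Aphi b t i * cos s - Cphi b i * sin s.
  by rewrite /Wphi /mix mxE /Aphi /Cphi /=; ring.
apply: (curve_integration_by_parts C1G (u := fun p => W b (t, p))
  (u' := fun p => Wphi b (t, p))) => //.
- move=> s i; apply: (is_derive_trig_eq (C := 0) _ (E s i)) => {}s.
  by rewrite /W /mix mxE /Aphi /Cphi /=; ring.
- by move=> i; apply: continuous_trig => s; exact: E.
- exact: continuous_cos.
- by rewrite sin0 sinpi !mul0r.
Qed.

Let by_parts_th b p :
  \int[lam]_(t in Theta) (sin t * grad b (t, p) Wth) =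
  - \int[lam]_(t in Theta) (cos t * G (W b (t, p))).
Proof.
have E s i : Wth b (s, p) i 0 = Ath p i * cos s - Cth b p i * sin s.
  by rewrite /Wth /mix mxE /Ath /Cth /=; ring.
apply: (curve_integration_by_parts C1G (u := fun t => W b (t, p))
  (u' := fun t => Wth b (t, p))) => //.
- move=> s i; apply: (is_derive_trig_eq
    (C := Cphi b i * cos p) _ (E s i)) => {}s.
  by rewrite /W /mix mxE /Ath /Cth /Cphi /=; ring.
- by move=> i; apply: continuous_trig => s; exact: E.
- exact: continuous_cos.
- by rewrite sin0 s2pi !mul0r.
Qed.

(** Integrating the first term by parts in the colatitude and the second one in
    the azimuth turns both into the integral of [- cos theta cos phi G]. *)
Let flux0 b : \int[angle_measure]_(z in angles) (sin z.2 * grad b z W') = 0.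
Proof.
under eq_Rintegral do rewrite gradE.
have b1 : bm (fun z => cos z.1 * (sin z.2 * grad b z Wphi)).
  by bm_angles; exact: bgrad.
have b2 : bm (fun z => cos z.2 * (sin z.1 * grad b z Wth)).
  by bm_angles; exact: bgrad.
have b3 : bm (fun z => cos z.1 * (cos z.2 * G (W b z))) by bm_angles.
rewrite (bm_integralB (mu := angle_measure) measurable_angles angles_lty)//.
have b1' : bm (fun z => sin z.2 * grad b z Wphi) by bm_angles; exact: bgrad.
have b2' : bm (fun z => sin z.1 * grad b z Wth) by bm_angles; exact: bgrad.
have b4 : bm (fun z => cos z.2 * G (W b z)) by bm_angles.
have b5 : bm (fun z => cos z.1 * G (W b z)) by bm_angles.
have mT : measurable Theta by [].
have mP : measurable Phi by [].
have lT : (lam Theta < +oo)%E by exact: itv_lty.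
have lP : (lam Phi < +oo)%E by exact: itv_lty.
apply/eqP; rewrite subr_eq0; apply/eqP.
transitivity (\int[angle_measure]_(z in angles) - (cos z.1 * (cos z.2 * G (W b z)))).
  rewrite -(bm_fubini1 (m1 := lam) (m2 := lam) mT mP lT lP b1).
  rewrite -(bm_fubini1 (m1 := lam) (m2 := lam) mT mP lT lP (bmN b3)).
  apply: eq_Rintegral => t /set_mem tT /=.
  rewrite (bm_integralZ (mu := lam) mP lP)/=; last exact: (bm_sectionl mT mP b1' tT).
  under [in RHS]eq_Rintegral do rewrite -mulNr.
  rewrite (bm_integralZ (mu := lam) mP lP)/=; last exact: (bm_sectionl mT mP b4 tT).
  by rewrite by_parts_phi mulrN mulNr.
rewrite -(bm_fubini2 (m1 := lam) (m2 := lam) mT mP lT lP b2).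
rewrite -(bm_fubini2 (m1 := lam) (m2 := lam) mT mP lT lP (bmN b3)).
apply: eq_Rintegral => p /set_mem pP /=.
rewrite (bm_integralZ (mu := lam) mT lT)/=; last exact: (bm_sectionr mT mP b2' pP).
under eq_Rintegral do rewrite mulrCA -mulNr.
rewrite (bm_integralZ (mu := lam) mT lT)/=; last exact: (bm_sectionr mT mP b5 pP).
by rewrite by_parts_th mulrN mulNr.
Qed.

Lemma sphere_integral_tilt b :
  \int[angle_measure]_(z in angles)
     (sin z.2 * G (B *m (rotV b *m spherical rho z.1 z.2))) =
  \int[angle_measure]_(z in angles) (sin z.2 * G (B *m spherical rho z.1 z.2)).
Proof.
transitivity (\int[angle_measure]_(z in angles) (sin z.2 * G (W b z))).
  by apply: eq_Rintegral => z _; rewrite /spherical rotV_vec3 mul_vec3.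
transitivity (\int[angle_measure]_(z in angles) (sin z.2 * G (W 0 z))); last first.
  apply: eq_Rintegral => z _; rewrite /spherical mul_vec3 /W /mix cos0 sin0.
  by rewrite !mul1r !mul0r addr0 subr0.
have sM (s : R) : `|sin s| <= 1 by exact: sin_max.
have cM (s : R) : `|cos s| <= 1 by exact: cos_max.
have le1 (x y z : R) : `|x| <= z -> `|y| <= 1 -> `|x * y| <= z.
  by move=> xz y1; rewrite normrM (le_trans _ xz)// ler_piMr.
have rM : `|rho| <= `|rho| by [].
have scM (x y s t : R) : `|x| <= `|rho| -> `|y| <= `|rho| -> `|s| <= 1 -> `|t| <= 1 ->
    `|s * x + t * y| <= `|rho| *+ 2.
  move=> ? ? ? ?; rewrite (le_trans (ler_normD _ _))// mulr2n.
  by rewrite lerD// mulrC le1.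
apply: (flow_integral_cst (mu := angle_measure) measurable_angles angles_lty (W' := W')
  (M := `|B| * (`|rho| *+ 2) *+ 3) C1G) => //.
- exact: bm_sin_colatitude.
- move=> {}b z i _; apply: lin3_le.
  + by apply: scM; rewrite ?le1.
  + by rewrite (@le_trans _ _ `|rho|) ?le1// mulr2n lerDl.
  + by rewrite -mulNr; apply: scM; rewrite ?normrN ?le1.
- move=> {}b z i _; apply: lin3_le.
  + by apply: scM; rewrite ?normrN ?le1.
  + by rewrite normr0 mulrn_wge0.
  + by rewrite -mulNr; apply: scM; rewrite ?normrN ?le1.
- move=> {}b z i; apply: (is_derive_trig_eq
    (A := B i 0 * (rho * cos z.2) - B i ord_max * (rho * sin z.2 * cos z.1))
    (B := B i 0 * (rho * sin z.2 * cos z.1) + B i ord_max * (rho * cos z.2))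
    (C := B i 1 * (rho * sin z.2 * sin z.1))) => [s|].
    by rewrite /W /mix mxE; ring.
  by rewrite /W' mxE; ring.
Qed.

End tilt.

Section turn.
Variables (B : 'M[R]_3) (rho : R).

(** Turning about the third axis is a shift of the azimuth, hence the derivative
    [W'] in the angle is also the derivative in the azimuth. *)
Let mix (b x y z : R) := lin3 B (cos b * x - sin b * y) (sin b * x + cos b * y) z.
Let W b (z : R * R) := mix b (rho * sin z.2 * cos z.1) (rho * sin z.2 * sin z.1)
  (rho * cos z.2).
Let W' b (z : R * R) := mix b (- (rho * sin z.2 * sin z.1)) (rho * sin z.2 * cos z.1) 0.

Let grad b z := \sum_i W' b z i 0 * g i (W b z).

Let bgrad b : bm (grad b).
Proof.
apply: bm_sum => i; apply: bmM; first by rewrite /W' /mix; bm_angles.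
apply: bm_continuous_comp => [||j]; first exact: measurable_angles.
  by have [_ /(_ i)[]] := C1G.
by rewrite /W /mix; bm_angles.
Qed.

Let A b (p : R) i := rho * sin p * (B i 1 * cos b - B i 0 * sin b).
Let C b (p : R) i := rho * sin p * (B i 0 * cos b + B i 1 * sin b).

(** The integral of a derivative over a closed circle. *)
Let circle0 b p : \int[lam]_(t in Theta) (1 * grad b (t, p)) = 0.
Proof.
have E s i : W' b (s, p) i 0 = A b p i * cos s - C b p i * sin s.
  by rewrite /W' /mix mxE /A /C /=; ring.
transitivity (- \int[lam]_(t in Theta) (0 * G (W b (t, p)))); last first.
  under eq_Rintegral do rewrite mul0r.
  by rewrite Rintegral_cst// mul0r oppr0.
apply: (curve_integration_by_parts C1G (u := fun t => W b (t, p))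
  (u' := fun t => W' b (t, p)) (h := fun=> 1) (h' := fun=> 0)) => //.
- move=> s i; apply: (is_derive_trig_eq
    (C := B i ord_max * (rho * cos p)) _ (E s i)) => {}s.
  by rewrite /W /mix mxE /A /C /=; ring.
- by move=> i; apply: continuous_trig => s; exact: E.
- exact: cst_continuous.
- by rewrite /W /= sin0 cos0 s2pi c2pi.
Qed.

Let flux0 b : \int[angle_measure]_(z in angles) (sin z.2 * grad b z) = 0.
Proof.
have mT : measurable Theta by [].
have mP : measurable Phi by [].
have lT : (lam Theta < +oo)%E by exact: itv_lty.
have lP : (lam Phi < +oo)%E by exact: itv_lty.
have b1 : bm (fun z => sin z.2 * grad b z) by bm_angles; exact: bgrad.
rewrite -(bm_fubini2 (m1 := lam) (m2 := lam) mT mP lT lP b1).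
rewrite -[RHS](mul0r (fine (lam Phi))) -Rintegral_cst//.
apply: eq_Rintegral => p /set_mem pP /=.
rewrite (bm_integralZ (mu := lam) mT lT)/=.
  by under eq_Rintegral do rewrite -[grad _ _]mul1r; rewrite circle0 mulr0.
exact: (bm_sectionr mT mP (bgrad b) pP).
Qed.

Lemma sphere_integral_turn a :
  \int[angle_measure]_(z in angles)
     (sin z.2 * G (B *m (rotU a *m spherical rho z.1 z.2))) =
  \int[angle_measure]_(z in angles) (sin z.2 * G (B *m spherical rho z.1 z.2)).
Proof.
transitivity (\int[angle_measure]_(z in angles) (sin z.2 * G (W a z))).
  by apply: eq_Rintegral => z _; rewrite /spherical rotU_vec3 mul_vec3.
transitivity (\int[angle_measure]_(z in angles) (sin z.2 * G (W 0 z))); last first.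
  apply: eq_Rintegral => z _; rewrite /spherical mul_vec3.
  by rewrite /W /mix cos0 sin0 !mul1r !mul0r add0r subr0.
have sM (s : R) : `|sin s| <= 1 by exact: sin_max.
have cM (s : R) : `|cos s| <= 1 by exact: cos_max.
have le1 (x y z : R) : `|x| <= z -> `|y| <= 1 -> `|x * y| <= z.
  by move=> xz y1; rewrite normrM (le_trans _ xz)// ler_piMr.
have rM : `|rho| <= `|rho| by [].
have scM (x y s t : R) : `|x| <= `|rho| -> `|y| <= `|rho| -> `|s| <= 1 -> `|t| <= 1 ->
    `|s * x + t * y| <= `|rho| *+ 2.
  move=> ? ? ? ?; rewrite (le_trans (ler_normD _ _))// mulr2n.
  by rewrite lerD// mulrC le1.
apply: (flow_integral_cst (mu := angle_measure) measurable_angles angles_lty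
  (W' := W') (M := `|B| * (`|rho| *+ 2) *+ 3) C1G) => //.
- exact: bm_sin_colatitude.
- by move=> b i; rewrite /W /mix; bm_angles.
- move=> b z i _; apply: lin3_le.
  + by rewrite -mulNr; apply: scM; rewrite ?normrN ?le1.
  + by apply: scM; rewrite ?le1.
  + by rewrite (@le_trans _ _ `|rho|) ?le1// mulr2n lerDl.
- move=> b z i _; apply: lin3_le.
  + by rewrite -[- (sin b * _)]mulNr; apply: scM; rewrite ?normrN ?le1.
  + by apply: scM; rewrite ?normrN ?le1.
  + by rewrite normr0 mulrn_wge0.
- move=> b z i; apply: (is_derive_trig_eq
    (A := B i 1 * (rho * sin z.2 * cos z.1) - B i 0 * (rho * sin z.2 * sin z.1))
    (B := B i 0 * (rho * sin z.2 * cos z.1) + B i 1 * (rho * sin z.2 * sin z.1))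
    (C := B i ord_max * (rho * cos z.2))) => [s|].
    by rewrite /W /mix mxE; ring.
  by rewrite /W' /mix mxE; ring.
Qed.

End turn.

Lemma sphere_integral_rot rho a b :
  \int[angle_measure]_(z in angles)
     (sin z.2 * G (rotU a *m rotV b *m spherical rho z.1 z.2)) =
  \int[angle_measure]_(z in angles) (sin z.2 * G (spherical rho z.1 z.2)).
Proof.
under eq_Rintegral do rewrite -mulmxA; rewrite sphere_integral_tilt.
under eq_Rintegral do rewrite -[rotU a *m _]mul1mx.
by rewrite sphere_integral_turn; under eq_Rintegral do rewrite mul1mx.
Qed.

End rotation_invariance.

(** * Moments and the Laplacian in the direction *)

Section quadratic_power.
Variable R : comNzRingType.

Definition quad (A B C : R) : {poly R} := A%:P + B *: 'X + C *: 'X^2.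

Lemma coef_quad A B C i : (quad A B C)`_i = [:: A; B; C]`_i.
Proof.
rewrite /quad !coefE; case: i => [|[|[|i]]] /=;
  by rewrite ?(mulr0, mulr1, addr0, add0r) ?nth_nil.
Qed.

Lemma size_quad A B C : (size (quad A B C) <= 3)%N.
Proof. by apply/leq_sizeP => -[|[|[|j]]]// _; rewrite coef_quad/= nth_nil. Qed.

Lemma horner_quad A B C t : (quad A B C).[t] = A + t * B + t ^+ 2 * C.
Proof. by rewrite /quad !(hornerD, hornerZ, hornerC, hornerX, hornerXn); ring. Qed.

Lemma coef_quadX A B C n :
  [/\ (quad A B C ^+ n)`_0 = A ^+ n,
      (quad A B C ^+ n)`_1 = n%:R * A ^+ n.-1 * B &
      (quad A B C ^+ n)`_2 = n%:R * A ^+ n.-1 * C +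
        'C(n, 2)%:R * A ^+ n.-2 * B ^+ 2].
Proof.
elim: n => [|n [c0 c1 c2]].
  by rewrite !expr0 !coef1; split=> //=; rewrite ?bin0n !mul0r ?addr0.
rewrite exprS !coefM !big_ord_recl !big_ord0 /= /bump /= !coef_quad /=.
rewrite !(addn0, add1n, subn0) ?subSS ?subn0 c0 c1 c2.
split; first by rewrite exprS addr0.
  case: n {c0 c1 c2} => [|n] /=; first by ring.
  by rewrite exprS -[n.+2%:R]natr1; ring.
rewrite binS bin1 natrD -[n.+1%:R]natr1.
case: n {c0 c1 c2} => [|[|n]] /=.
- by rewrite bin0n /=; ring.
- by rewrite bin_small//; ring.
- rewrite !exprS -![n.+2%:R]natr1 -![n.+1%:R]natr1; ring.
Qed.

End quadratic_power.

Lemma poly_eq0_of_horner (R : realType) (p : {poly R}) :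
  (forall t, p.[t] = 0) -> p = 0.
Proof.
move=> p0; apply/eqP; apply: contraT => /max_poly_roots H.
have /H : all (root p) [seq i%:R | i <- iota 0 (size p)].
  by apply/allP => x _; rewrite /root p0.
rewrite size_map size_iota ltnn => /(_ _)-> //.
rewrite map_inj_uniq ?iota_uniq// => i j /eqP; rewrite eqr_nat => /eqP//.
Qed.

Section transversal_moments.
Variable R : realType.
Implicit Types (x y v w : 'cV[R]_3).

Definition sqn x : R := \sum_i x i 0 ^+ 2.
Definition dotp x y : R := \sum_i x i 0 * y i 0.

(** The squared norm of the cross product of [w] and [y]. *)
Definition cross2 w y : R := sqn y * sqn w - dotp y w ^+ 2.

Lemma cdiff_sqn : continuously_differentiable sqn.
Proof. by apply: cdiff_sum => i; apply: cdiffX; exact: cdiff_coord. Qed.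

Lemma cdiff_cross2 w : continuously_differentiable (cross2 w).
Proof.
have cd : continuously_differentiable (fun x : 'cV[R]_3 => dotp x w).
  by apply: cdiff_sum => i; apply: cdiffM; [exact: cdiff_coord|exact: cdiff_cst].
rewrite (_ : cross2 w = fun x => sqn x * sqn w + (-1) * (dotp x w * dotp x w)).
  apply: cdiffD; apply: cdiffM; try exact: cdiff_cst.
    exact: cdiff_sqn.
  exact: cdiffM.
by apply/funext => x; rewrite /cross2; ring.
Qed.

(** [B] and [C] are half the linear coefficient and the quadratic coefficient of
    [cross2] along the [i]-th axis. *)
Let B w y i : R := sqn y * w i 0 - dotp y w * y i 0.
Let C y i : R := sqn y - y i 0 ^+ 2.

Lemma sum3 (F : 'I_3 -> R) : \sum_i F i = F 0 + F 1 + F ord_max.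
Proof.
rewrite !big_ord_recl big_ord0 addr0 addrA.
by congr (_ + F _ + F _); exact: val_inj.
Qed.

Lemma ord3P (P : 'I_3 -> Prop) : P 0 -> P 1 -> P ord_max -> forall i, P i.
Proof.
move=> P0 P1 P2 [[|[|[|//]]] i].
- by rewrite (_ : Ordinal i = 0)//; exact: val_inj.
- by rewrite (_ : Ordinal i = 1)//; exact: val_inj.
- by rewrite (_ : Ordinal i = ord_max)//; exact: val_inj.
Qed.

Lemma cross2_shift w y i t :
  cross2 (w + t *: delta_mx i 0) y = (quad (cross2 w y) (2 * B w y i) (C y i)).[t].
Proof.
rewrite horner_quad /cross2 /B /C /sqn /dotp !sum3 !mxE.
by elim/ord3P : i => /=; rewrite !(mulr1, mulr0, addr0); ring.
Qed.

Let sumB w y : \sum_i B w y i ^+ 2 = sqn y * cross2 w y.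
Proof. by rewrite /B /cross2 /sqn /dotp !sum3; ring. Qed.

Let sumC y : \sum_i C y i = 2 * sqn y.
Proof. by rewrite /C /sqn !sum3; ring. Qed.

(** The second order coefficients along the three axes add up to half the
    Laplacian in [w] of [cross2 w y ^+ k.+1]. *)
Lemma sum_coef2_cross2 w y k :
  \sum_i (quad (cross2 w y) (2 * B w y i) (C y i) ^+ k.+1)`_2 =
  2 * k.+1%:R ^+ 2 * (sqn y * cross2 w y ^+ k).
Proof.
transitivity (\sum_i (k.+1%:R * cross2 w y ^+ k * C y i +
    'C(k.+1, 2)%:R * cross2 w y ^+ k.-1 * (4 * B w y i ^+ 2))).
  apply: eq_bigr => i _; have [_ _ ->] := coef_quadX (cross2 w y) (2 * B w y i) (C y i) k.+1.
  by congr (_ + _ * _); ring.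
rewrite big_split /= -!mulr_sumr sumB sumC.
case: k => [|k] /=; first by rewrite bin_small//; ring.
have : (2 * 'C(k.+2, 2) = k.+2 * k.+1)%N.
  by rewrite -[2%N in LHS]/(2`!) mulnC bin_ffact ffactSS ffactn1.
move/(congr1 (fun n => n%:R : R)); rewrite !natrM => E.
rewrite exprS -[k.+2%:R]natr1 in E *.
set c := 'C(_, _)%:R in E *.
transitivity ((k.+1%:R + 1) * (cross2 w y * cross2 w y ^+ k) * (2 * sqn y) +
  2 * c * (2 * (cross2 w y * cross2 w y ^+ k) * sqn y)); first by ring.
by rewrite E; ring.
Qed.

Context d (T : measurableType d) (mu : {measure set T -> \bar R}) (D : set T).
Hypotheses (mD : measurable D) (muD : (mu D < +oo)%E).
Variables (y : T -> 'cV[R]_3) (c : T -> R).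
Hypotheses (by_ : forall i, bounded_mfun D (fun z => y z i 0))
  (bc : bounded_mfun D c).

Lemma bm_sqn : bounded_mfun D (fun z => sqn (y z)).
Proof. by apply: bm_sum => i; exact: bmX. Qed.

Lemma bm_dotp w : bounded_mfun D (fun z => dotp (y z) w).
Proof. by apply: bm_sum => i; apply: bmM => //; exact: bm_cst. Qed.

Lemma bm_cross2 w : bounded_mfun D (fun z => cross2 w (y z)).
Proof.
apply: bmB; last exact: bmX (bm_dotp w).
by apply: bmM; [exact: bm_sqn|exact: bm_cst].
Qed.

Let bm_coefX (p : T -> {poly R}) n : (forall j, bounded_mfun D (fun z => (p z)`_j)) ->
  forall j, bounded_mfun D (fun z => (p z ^+ n)`_j).
Proof.
move=> bp; elim: n => [|n IH] j.
  by under eq_fun do rewrite expr0; exact: bm_cst.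
under eq_fun do rewrite exprS coefM.
by apply: bm_sum => i; apply: bmM.
Qed.

(** The moment along the line [w + t e_i] is a polynomial in [t] whose
    coefficients are again moments.  It vanishes for all [t], so its coefficient
    of degree two does; summing over [i] gives the Laplacian. *)
Lemma laplacian_step :
  (forall k w, \int[mu]_(z in D) (c z * cross2 w (y z) ^+ k) = 0) ->
  forall k w, \int[mu]_(z in D) (c z * sqn (y z) * cross2 w (y z) ^+ k) = 0.
Proof.
move=> H k w.
pose p i z := quad (cross2 w (y z)) (2 * B w (y z) i) (C (y z) i).
have bp i n j : bounded_mfun D (fun z => (p i z ^+ n)`_j).
  apply: bm_coefX => {}j; rewrite /p.
  under eq_fun do rewrite coef_quad.
  case: j => [|[|[|j]]] /=; last by under eq_fun do rewrite nth_nil; exact: bm_cst.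
  - exact: bm_cross2.
  - apply: bmM; first exact: bm_cst.
    by apply: bmB; apply: bmM; [exact: bm_sqn|exact: bm_cst|exact: bm_dotp|].
  - by apply: bmB; [exact: bm_sqn|exact: bmX].
have coef0 i : \int[mu]_(z in D) (c z * (p i z ^+ k.+1)`_2) = 0.
  (* A power [k + 1] of a polynomial of degree two has degree at most [2 k + 2]. *)
  pose N := (2 * k.+1).+1.
  pose q := \poly_(j < N) \int[mu]_(z in D) (c z * (p i z ^+ k.+1)`_j).
  suff -> : \int[mu]_(z in D) (c z * (p i z ^+ k.+1)`_2) = q`_2.
    rewrite (_ : q = 0) ?coef0//; apply: poly_eq0_of_horner => t.
    rewrite horner_poly -[RHS](H k.+1 (w + t *: delta_mx i 0)).
    under [RHS]eq_Rintegral => z _.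
      rewrite cross2_shift -/(p i z) -horner_exp (@horner_coef_wide _ N).
        by rewrite mulr_sumr; over.
      rewrite (leq_trans (size_poly_exp_leq _ _))// ltnS leq_mul2r.
      by rewrite -subn1 leq_subLR size_quad orbT.
    rewrite (bm_integral_sum mD muD); last first.
      move=> j; apply: bmM => //; apply: bmM; first exact: bp.
      exact: bm_cst.
    apply: eq_bigr => j _; rewrite mulrC -(bm_integralZ mD muD); last exact: bmM.
    by apply: eq_Rintegral => z _; ring.
  by rewrite coef_poly ifT// /N ltnS leq_pmulr.
apply/eqP; rewrite -(mulrI_eq0 _ (mulfI _ : GRing.lreg (2 * k.+1%:R ^+ 2))); last first.
  by rewrite mulf_neq0 ?expf_neq0 ?pnatr_eq0.
apply/eqP; rewrite -(bm_integralZ mD muD); last first.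
  by apply: bmM; [apply: bmM => //; exact: bm_sqn|apply: bmX; exact: bm_cross2].
transitivity (\sum_i \int[mu]_(z in D) (c z * (p i z ^+ k.+1)`_2)); last first.
  by rewrite big1.
rewrite -(bm_integral_sum mD muD); last by move=> i; exact: bmM.
apply: eq_Rintegral => z _; rewrite -mulr_sumr sum_coef2_cross2; ring.
Qed.

End transversal_moments.

Lemma transversal_moments_sqn (R : realType) d (T : measurableType d)
    (mu : {measure set T -> \bar R}) (D : set T) (y : T -> 'cV[R]_3) (c : T -> R) :
  measurable D -> (mu D < +oo)%E ->
  (forall i, bounded_mfun D (fun z => y z i 0)) -> bounded_mfun D c ->
  (forall k w, \int[mu]_(z in D) (c z * cross2 w (y z) ^+ k) = 0) ->
  forall m k w, \int[mu]_(z in D) (c z * (sqn (y z) ^+ m * cross2 w (y z) ^+ k)) = 0.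
Proof.
move=> mD muD by_ + + m; elim: m c => [|m IH] c bc H k w.
  by under eq_Rintegral do rewrite expr0 mul1r; exact: H.
under eq_Rintegral do rewrite exprS -(mulrA (sqn _)) (mulrA (c _)).
apply: (IH (fun z => c z * sqn (y z))) => //.
  by apply: bmM => //; exact: bm_sqn.
exact: laplacian_step.
Qed.

(** * From sublevel sets to moments *)

Section sublevel_moments.
Context d (T : measurableType d) (R : realType).
Variables (mu : {sigma_finite_measure set T -> \bar R}) (D : set T).
Hypotheses (mD : measurable D) (muD : (mu D < +oo)%E).
Variables (sigma : T -> R).
Hypotheses (bs : bounded_mfun D sigma) (s0 : forall z, D z -> 0 <= sigma z).
Local Notation lam := (@lebesgue_measure R).

Lemma integral_sublevel (s t : R) : 0 <= s -> 0 < t ->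
  \int[lam]_(x in `]0, t]) (s <= x)%R%:R = (t - s) * (s <= t)%R%:R.
Proof.
move=> s0' t0.
have -> : \int[lam]_(x in `]0, t]) (s <= x)%R%:R =
    fine (lam (`[s, +oo[ `&` `]0, t])).
  rewrite -integral_indic// /Rintegral; congr fine.
  apply: eq_integral => x _; rewrite indicE; congr (_%:R%:E).
  by rewrite mem_setE in_itv/= andbT.
have [st|ts] := leP s t; last first.
  rewrite mulr0 (_ : _ `&` _ = set0) ?measure0//.
  apply/seteqP; split => // x /=; rewrite !in_itv/= andbT => -[sx /andP[_ xt]].
  by have := le_lt_trans (le_trans sx xt) ts; rewrite ltxx.
rewrite mulr1; move: s0'; rewrite le_eqVlt => /predU1P[<-|s0'].
  rewrite (_ : _ `&` _ = `]0, t]%classic).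
    by rewrite lebesgue_measure_itv/= lte_fin t0 subr0 EFinN sube0.
  apply/seteqP; split => x /=; rewrite !in_itv/= andbT; first by case.
  by move=> /andP[x0 ->]; rewrite x0 ltW.
rewrite (_ : _ `&` _ = `[s, t]%classic).
  rewrite lebesgue_measure_itv/= lte_fin; case: ltP => [//|ts].
  by rewrite (_ : s = t) ?subrr//; apply/eqP; rewrite eq_le st ts.
apply/seteqP; split => x /=; rewrite !in_itv/= andbT.
  by move=> [-> /andP[_ ->]].
by move=> /andP[sx ->]; rewrite sx (lt_le_trans s0' sx).
Qed.

(** Where [sigma <= t], the difference [t - sigma] is the length of the interval
    of the [s <= t] with [sigma <= s]; exchanging the integrals over [z] and [s]
    leaves sublevel integrals of [g] only.  The range of [s] excludes [0], where
    nothing is assumed. *)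
Lemma sublevel_step (g : T -> R) : bounded_mfun D g ->
  (forall t, 0 < t -> \int[mu]_(z in D) (g z * (sigma z <= t)%R%:R) = 0) ->
  forall t, 0 < t -> \int[mu]_(z in D) (g z * sigma z * (sigma z <= t)%R%:R) = 0.
Proof.
move=> bg H t t0.
have mI : measurable (`]0, t]%classic : set R) by [].
have lI : (lam `]0%R, t] < +oo)%E.
  by rewrite lebesgue_measure_itv/=; case: ifP; rewrite ?ltry.
have bst : bounded_mfun D (fun z => (sigma z <= t)%R%:R : R).
  by apply: bm_le => //; have [] := bs.
have b1 : bounded_mfun D (fun z => g z * (sigma z <= t)%R%:R) by exact: bmM.
have bF : bounded_mfun (D `*` `]0, t]) (fun p => g p.1 * (sigma p.1 <= p.2)%R%:R).
  apply: bmM; first exact: bm_fst.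
  apply: bm_le; first exact: measurableX.
    by have [] := bm_fst mD mI bs.
  exact: measurable_funTS.
have b2 : bounded_mfun D (fun z => \int[lam]_(s in `]0, t]) (g z * (sigma z <= s)%R%:R)).
  exact: (bm_partial_integral (m1 := mu) (m2 := lam) mD mI muD lI bF).
transitivity (\int[mu]_(z in D) (t * (g z * (sigma z <= t)%R%:R) -
    \int[lam]_(s in `]0, t]) (g z * (sigma z <= s)%R%:R))).
  apply: eq_Rintegral => z /set_mem Dz.
  rewrite (bm_integralZ (mu := lam) mI lI).
    by rewrite integral_sublevel ?s0//; ring.
  apply: bm_le => //; exact: measurable_cst.
rewrite (bm_integralB mD muD)//; last by apply: bmM => //; exact: bm_cst.
rewrite (bm_integralZ mD muD)// H// mulr0 sub0r.
rewrite (bm_fubini (m1 := mu) (m2 := lam) mD mI muD lI bF).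
apply/eqP; rewrite oppr_eq0; apply/eqP.
rewrite -[RHS](mul0r (fine (lam `]0, t]))) -Rintegral_cst//.
apply: eq_Rintegral => s /set_mem /=; rewrite in_itv/= => /andP[s0' _].
exact: H.
Qed.

(** Iterating [sublevel_step] and then taking [t] above the bound of [sigma]. *)
Lemma sublevel_moments (g : T -> R) : bounded_mfun D g ->
  (forall t, 0 < t -> \int[mu]_(z in D) (g z * (sigma z <= t)%R%:R) = 0) ->
  forall m, \int[mu]_(z in D) (g z * sigma z ^+ m) = 0.
Proof.
move=> bg H m.
have [bgm Hm] : bounded_mfun D (fun z => g z * sigma z ^+ m) /\ forall t, 0 < t ->
    \int[mu]_(z in D) (g z * sigma z ^+ m * (sigma z <= t)%R%:R) = 0.
  elim: m => [|m [bm IH]].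
    under eq_fun do rewrite expr0 mulr1; split => // t t0.
    by under eq_Rintegral do rewrite expr0 mulr1; exact: H.
  split; first by apply: bmM => //; exact: bmX.
  move=> t t0; under eq_Rintegral do rewrite exprSr mulrA.
  exact: sublevel_step.
have [_ [M sM]] := bs.
rewrite -(Hm (`|M| + 1)) ?ltr_pwDr//; apply: eq_Rintegral => z /set_mem Dz.
rewrite (_ : _ <= _) ?mulr1//.
by rewrite (le_trans (ler_norm _))// (le_trans (sM z Dz))// (le_trans (ler_norm _))// lerDl.
Qed.

End sublevel_moments.

(** * Concentration of powers *)

Section concentration.
Context d (T : measurableType d) (R : realType).
Variables (mu : {measure set T -> \bar R}) (D A : set T) (g q : T -> R) (a b c : R).
Hypotheses (mD : measurable D) (muD : (mu D < +oo)%E).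
Hypotheses (mA : measurable A) (AD : A `<=` D) (muA : (0 < mu A)%E).
Hypotheses (bg : bounded_mfun D g) (bq : bounded_mfun D q).
Hypotheses (c0 : 0 < c) (b0 : 0 <= b) (ba : b < a).
Hypothesis q0 : forall z, D z -> 0 <= q z.
Hypothesis gA : forall z, A z -> c <= g z.
Hypothesis qA : forall z, A z -> a <= q z.
Hypothesis gq : forall z, D z -> b < q z -> 0 <= g z.

(** The mass of [g * q ^+ n] on [A] is at least of order [a ^+ n], and its
    negative part lives where [q <= b], so it is at most of order [b ^+ n]. *)
Lemma powers_concentrate : ~ (forall n, \int[mu]_(z in D) (g z * q z ^+ n) = 0).
Proof.
move=> H.
have [_ [C gC]] := bg.
have a0 : 0 < a := le_lt_trans b0 ba.
have muAD : (mu A <= mu D)%E by rewrite le_measure ?inE.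
have muAfin : mu A \is a fin_num by rewrite ge0_fin_numE ?(le_lt_trans muAD).
have mA0 : 0 < fine (mu A) by rewrite fine_gt0// muA (le_lt_trans muAD).
have bA : bounded_mfun D (\1_A : T -> R).
  split; first exact: measurable_indic.
  by exists 1 => z _; rewrite indicE; case: (_ \in _); rewrite ?normr1 ?normr0.
have low n z : D z -> c * a ^+ n * \1_A z - `|C| * b ^+ n <= g z * q z ^+ n.
  move=> Dz; rewrite indicE; have [/set_mem Az|_] := boolP (z \in A).
    rewrite mulr1 lerBlDr (le_trans (y := g z * q z ^+ n))//; last first.
      by rewrite lerDl mulr_ge0// exprn_ge0.
    by rewrite ler_pM ?exprn_ge0 ?lerXn2r ?nnegrE ?q0 ?gA ?qA// ltW.
  rewrite mulr0 sub0r; have [qb|bq'] := leP (q z) b; last first.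
    rewrite (@le_trans _ _ 0)//; last by rewrite mulr_ge0 ?exprn_ge0 ?q0 ?gq.
    by rewrite oppr_le0 mulr_ge0 ?exprn_ge0.
  rewrite lerNl (le_trans (ler_norm _))// normrN normrM ler_pM//.
    by rewrite (le_trans (gC _ Dz))// ler_norm.
  by rewrite ger0_norm ?exprn_ge0 ?q0// lerXn2r ?nnegrE ?q0.
have key n : c * fine (mu A) <= `|C| * fine (mu D) * (b / a) ^+ n.
  have := H n; have : \int[mu]_(z in D) (c * a ^+ n * \1_A z - `|C| * b ^+ n) <=
      \int[mu]_(z in D) (g z * q z ^+ n).
    apply: le_Rintegral => //.
    - apply: bm_integrable => //; apply: bmB; last exact: bm_cst.
      by apply: bmM => //; exact: bm_cst.
    - by apply: bm_integrable => //; apply: bmM => //; exact: bmX.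
    - by move=> z Dz; exact: low.
  move=> + E; rewrite E (bm_integralB mD muD); last exact: bm_cst.
    rewrite (bm_integralZ mD muD)// Rintegral_cst//.
    have -> : \int[mu]_(z in D) \1_A z = fine (mu A).
      by rewrite /Rintegral integral_indic// (setIidl AD).
    rewrite subr_le0 => I; rewrite expr_div_n mulrA ler_pdivlMr ?exprn_gt0//.
    by rewrite [leLHS]mulrAC (le_trans I)// mulrAC.
  by apply: bmM => //; exact: bm_cst.
have L : `|C| * fine (mu D) * (b / a) ^+ n @[n --> \oo] --> `|C| * fine (mu D) * 0.
  apply: cvgM; first exact: cvg_cst.
  by apply: cvg_expr; rewrite ger0_norm ?divr_ge0// ?ltW// ltr_pdivrMr ?mul1r.
have : c * fine (mu A) <= `|C| * fine (mu D) * 0.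
  by apply: (cvgr_to_ge L); exact: nearW.
by rewrite mulr0 leNgt mulr_gt0.
Qed.

End concentration.

(** * Spherical coordinates and spindles *)

Section geometry.
Variable R : realType.
Implicit Types (x y w : 'cV[R]_3).

Lemma sqn_ge0 x : 0 <= sqn x.
Proof. by apply: sumr_ge0 => i _; exact: sqr_ge0. Qed.

Lemma sqn_eq0 x : sqn x = 0 -> x = 0.
Proof.
move=> /eqP; rewrite psumr_eq0; last by move=> i _; exact: sqr_ge0.
move=> /allP H; apply/colP => i; rewrite mxE.
by have := H i (mem_index_enum i); rewrite /= sqrf_eq0 => /eqP.
Qed.

Lemma enormE x : enorm x = Num.sqrt (sqn x). Proof. by []. Qed.

Lemma enorm_sqr x : enorm x ^+ 2 = sqn x.
Proof. by rewrite sqr_sqrtr// sqn_ge0. Qed.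

Lemma dotp_rotU (a : R) x y : dotp (rotU a *m x) (rotU a *m y) = dotp x y.
Proof.
rewrite (vec3P x) (vec3P y) !rotU_vec3 /dotp !sum3 !mxE /=.
have := sin2cos2 a; rewrite !expr2 => E; ring: E.
Qed.

Lemma dotp_rotV (a : R) x y : dotp (rotV a *m x) (rotV a *m y) = dotp x y.
Proof.
rewrite (vec3P x) (vec3P y) !rotV_vec3 /dotp !sum3 !mxE /=.
have := sin2cos2 a; rewrite !expr2 => E; ring: E.
Qed.

Lemma sqn_dotp x : sqn x = dotp x x.
Proof. by apply: eq_bigr => i _; rewrite expr2. Qed.

Lemma dotp_rot (a b : R) x y :
  dotp (rotU a *m rotV b *m x) (rotU a *m rotV b *m y) = dotp x y.
Proof. by rewrite -!mulmxA dotp_rotU dotp_rotV. Qed.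

Lemma sqn_rot (a b : R) x : sqn (rotU a *m rotV b *m x) = sqn x.
Proof. by rewrite !sqn_dotp dotp_rot. Qed.

Lemma cross2_rot (a b : R) w x :
  cross2 (rotU a *m rotV b *m w) (rotU a *m rotV b *m x) = cross2 w x.
Proof. by rewrite /cross2 !sqn_rot dotp_rot. Qed.

Lemma sqn_spherical (rho t p : R) : sqn (spherical rho t p) = rho ^+ 2.
Proof.
rewrite /sqn sum3 !mxE /=.
have := sin2cos2 t; have := sin2cos2 p; rewrite !expr2 => E1 E2; ring: E1 E2.
Qed.

Lemma cross2_axis_spherical (h rho t p : R) :
  cross2 (vec3 0 0 h) (spherical rho t p) = h ^+ 2 * (rho * sin p) ^+ 2.
Proof.
rewrite /cross2 sqn_spherical /sqn /dotp !sum3 !mxE /=.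
have := sin2cos2 p; rewrite !expr2 => E; ring: E.
Qed.

Lemma rot_axis (a b h : R) : rotU a *m rotV b *m vec3 0 0 h = spherical h a b.
Proof.
rewrite -mulmxA rotV_vec3 rotU_vec3 /spherical; congr vec3; ring.
Qed.

(** Lagrange's identity. *)
Lemma cross2_ge0 w x : 0 <= cross2 w x.
Proof.
have -> : cross2 w x = (w 0 0 * x 1 0 - w 1 0 * x 0 0) ^+ 2 +
   (w 1 0 * x ord_max 0 - w ord_max 0 * x 1 0) ^+ 2 +
   (w ord_max 0 * x 0 0 - w 0 0 * x ord_max 0) ^+ 2.
  by rewrite /cross2 /sqn /dotp !sum3; ring.
by rewrite !addr_ge0 ?sqr_ge0.
Qed.

Lemma sqnZ (k : R) x : sqn (k *: x) = k ^+ 2 * sqn x.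
Proof. by rewrite /sqn !sum3 !mxE; ring. Qed.

Lemma cross2Zr (k : R) w x : cross2 w (k *: x) = k ^+ 2 * cross2 w x.
Proof. by rewrite /cross2 /dotp /sqn !sum3 !mxE; ring. Qed.

Lemma cross2Zl (k : R) w x : cross2 (k *: w) x = k ^+ 2 * cross2 w x.
Proof. by rewrite /cross2 /dotp /sqn !sum3 !mxE; ring. Qed.

Lemma unit_circle_angle (c s : R) : c ^+ 2 + s ^+ 2 = 1 ->
  exists2 t, 0 <= t <= 2 * pi & c = cos t /\ s = sin t.
Proof.
move=> cs.
have c1 : -1 <= c <= 1.
  by rewrite -ler_norml -(expr_le1 (n := 2))// real_normK ?num_real//; nra.
have sE : Num.sqrt (1 - c ^+ 2) = `|s|.
  by rewrite -cs addrAC subrr add0r sqrtr_sqr.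
have a0 := acos_ge0 c1; have api := acos_lepi c1.
have pi0 := pi_ge0 R.
have [s0|s0] := leP 0 s.
  exists (acos c); first by rewrite a0/=; lra.
  by rewrite acosK ?in_itv//= sin_acos// sE ger0_norm.
exists (2 * pi - acos c); first by apply/andP; split; lra.
rewrite addrC mulr_natl cosD2pi sinD2pi cosN sinN acosK ?in_itv//=.
by rewrite sin_acos// sE ltr0_norm// opprK.
Qed.

Lemma spherical_coordinates x : exists t p,
  [/\ 0 <= t <= 2 * pi, 0 <= p <= pi & x = spherical (enorm x) t p].
Proof.
set r := enorm x.
have r2 := enorm_sqr x; rewrite -/r /sqn sum3 in r2.
have r0 : 0 <= r by exact: sqrtr_ge0.
have [r00|rn0] := eqVneq r 0.
  exists 0, 0; rewrite lexx mulr_ge0 ?pi_ge0//; split => //.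
  have -> : x = 0 by apply: sqn_eq0; rewrite -enorm_sqr -/r r00 expr0n.
  by apply/colP; elim/ord3P; rewrite !mxE r00 /= ?mul0r.
have rp : 0 < r by rewrite lt_def rn0.
have c1 : -1 <= x ord_max 0 / r <= 1.
  rewrite -ler_norml normf_div (ger0_norm r0) ler_pdivrMr// mul1r.
  by rewrite -(ler_pXn2r (n := 2))// ?nnegrE// real_normK ?num_real// r2; nra.
pose p := acos (x ord_max 0 / r).
have cp : cos p = x ord_max 0 / r by rewrite acosK ?in_itv.
have p0 : 0 <= p <= pi by rewrite acos_ge0 ?acos_lepi.
have xp : r * cos p = x ord_max 0 by rewrite cp mulrC divfK.
have sp2 : (r * sin p) ^+ 2 = x 0 0 ^+ 2 + x 1 0 ^+ 2.
  by rewrite exprMn sin2cos2 mulrBr mulr1 -exprMn xp r2; ring.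
have [q0|qn0] := eqVneq (r * sin p) 0.
  exists 0, p; rewrite lexx mulr_ge0 ?pi_ge0//; split => //.
  move: sp2; rewrite q0 expr0n/= => /esym/eqP; rewrite paddr_eq0 ?sqr_ge0//.
  rewrite !sqrf_eq0 => /andP[/eqP x0 /eqP x1].
  by apply/colP; elim/ord3P; rewrite !mxE /= ?q0 ?mul0r.
have [|t t0 [ct st]] := @unit_circle_angle (x 0 0 / (r * sin p)) (x 1 0 / (r * sin p)).
  by rewrite !expr_div_n -mulrDl -sp2 divff// expf_neq0.
exists t, p; split => //.
by apply/colP; elim/ord3P; rewrite !mxE /= -?ct -?st ?xp// mulrC divfK.
Qed.

(** Adding [r sin phi] on both sides and squaring turns the spindle into the
    cylinder of radius [t = 1 / (2 r)] in the stretched radius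
    [rho / (1 - rho ^+ 2)]. *)
Lemma le_spindle_radius (t rho p : R) : 0 < t -> 0 <= rho -> rho < 1 -> 0 <= sin p ->
  (rho <= spindle_radius (2 * t)^-1 p) = (rho / (1 - rho ^+ 2) * sin p <= t).
Proof.
move=> t0 r0 r1 s0.
set k := (2 * t)^-1; rewrite /spindle_radius lerBrDr.
have k0 : 0 < k by rewrite invr_gt0 mulr_gt0.
have ks : 0 <= k * sin p by rewrite mulr_ge0// ltW.
have d0 : 0 < 1 - rho ^+ 2 by nra.
rewrite -(ler_pXn2r (n := 2))// ?nnegrE ?addr_ge0 ?sqrtr_ge0//.
rewrite sqr_sqrtr; last by rewrite -exprMn addr_ge0 ?sqr_ge0 ?ler01.
rewrite [rho / _ * _]mulrAC ler_pdivrMr//.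
have -> : (rho + k * sin p) ^+ 2 <= k ^+ 2 * sin p ^+ 2 + 1 =
    (k * (2 * rho * sin p) <= 1 - rho ^+ 2).
  by apply/idP/idP => ?; lra.
rewrite /k mulrC ler_pdivrMr ?mulr_gt0//.
by apply/idP/idP => ?; lra.
Qed.

End geometry.

(** * The transform as one integral over a box *)

Section box.
Variables (R : realType) (e : R).
Local Notation lam := (@lebesgue_measure R).
Local Notation Theta := `[0, 2 * (pi : R)]%classic.
Local Notation Phi := `[0, (pi : R)]%classic.
Local Notation Rho := `[0, e]%classic.
Local Notation angle_measure := (sfprod lam lam).
Local Notation box_measure := (sfprod angle_measure lam).
Local Notation angles := (@angles R).

(** A triple consists of the pair (azimuth, colatitude) and the radius, in this
    order, as in the iterated integral of the transform. *)
Definition box : set (R * R * R) := angles `*` Rho.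
Local Notation bm := (bounded_mfun box).

Definition box_point (z : R * R * R) : 'cV[R]_3 := spherical z.2 z.1.1 z.1.2.

Let mT : measurable Theta. Proof. by []. Qed.
Let mP : measurable Phi. Proof. by []. Qed.
Let mR : measurable Rho. Proof. by []. Qed.
Let mA : measurable angles. Proof. exact: measurable_angles. Qed.

Lemma measurable_box : measurable box.
Proof. exact: measurableX. Qed.

Lemma box_lty : (box_measure box < +oo)%E.
Proof.
exact: (product_setX_lty (m1 := angle_measure) (m2 := lam) mA mR
  (angles_lty R) (itv_lty 0 e)).
Qed.

Lemma bm_sin_theta : bm (fun z => sin z.1.1).
Proof. exact: (bm_fst mA mR (bm_sin_azimuth R)). Qed.
Lemma bm_cos_theta : bm (fun z => cos z.1.1).
Proof. exact: (bm_fst mA mR (bm_cos_azimuth R)). Qed.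
Lemma bm_sin_phi : bm (fun z => sin z.1.2).
Proof. exact: (bm_fst mA mR (bm_sin_colatitude R)). Qed.
Lemma bm_cos_phi : bm (fun z => cos z.1.2).
Proof. exact: (bm_fst mA mR (bm_cos_colatitude R)). Qed.

Lemma bm_radial (f : R -> R) : continuous f -> bm (fun z => f z.2).
Proof.
move=> cf; apply: (bm_snd (f := f) mA mR); split.
  by apply: measurable_funTS; exact: continuous_measurable_fun.
have /compact_bounded[M [_ MP]] : compact (f @` Rho).
  exact: (continuous_compact (continuous_subspaceT cf) (@segment_compact R 0 e)).
exists (M + 1) => x Rx; apply: (MP (M + 1)); first by rewrite ltrDl.
by exists x.
Qed.

Lemma bm_rho : bm (fun z => z.2).
Proof. by apply: (bm_radial (f := id)) => x. Qed.

Ltac bm_box := repeat first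
  [ exact: bm_sin_theta | exact: bm_cos_theta | exact: bm_sin_phi
  | exact: bm_cos_phi | exact: bm_rho | exact: bm_cst
  | apply: bm_lin3 | apply: bmB | apply: bmD | apply: bmN | apply: bmX | apply: bmM ].

Lemma bm_mul_box_point (B : 'M[R]_3) i : bm (fun z => (B *m box_point z) i 0).
Proof. by under eq_fun do rewrite mul_vec3; bm_box. Qed.

Lemma bm_box_point i : bm (fun z => box_point z i 0).
Proof. by have := bm_mul_box_point 1%:M i; under eq_fun do rewrite mul1mx. Qed.

Lemma bm_comp_box_point (F : 'cV[R]_3 -> R) (B : 'M[R]_3) : continuous F ->
  bm (fun z => F (B *m box_point z)).
Proof.
move=> cF; apply: bm_continuous_comp => //; first exact: measurable_box.
by move=> i; exact: bm_mul_box_point.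
Qed.

Variables (F : 'cV[R]_3 -> R).
Hypothesis cF : continuous F.
Hypothesis F_out : forall x, e < enorm x -> F x = 0.

Let weight (B : 'M[R]_3) z : R := z.2 ^+ 2 * sin z.1.2 * F (B *m box_point z).

Lemma bm_weight B : bm (weight B).
Proof. by rewrite /weight; bm_box; exact: bm_comp_box_point. Qed.

Lemma bm_spindle_integrand B r :
  bm (fun z => weight B z * (z.2 <= spindle_radius r z.1.2)%R%:R).
Proof.
have cs : continuous (spindle_radius r).
  move=> p; apply: cvgB.
    apply: (@cvg_comp _ _ _ _ Num.sqrt _ _ _ _ (@sqrt_continuous R _)).
    apply: cvgD; last exact: cvg_cst.
    by apply: cvgM; [exact: cvg_cst|apply: cvgM; exact: continuous_sin].
  by apply: cvgM; [exact: cvg_cst|exact: continuous_sin].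
apply: bmM; first exact: bm_weight.
apply: bm_le; first exact: measurable_box.
  by have [] := bm_rho.
apply: measurable_funTS; apply: (measurableT_comp (continuous_measurable_fun cs)).
exact: measurableT_comp.
Qed.

(** Beyond the radius [e] the function vanishes, so the radial integral can be
    taken over the fixed interval [`[0, e]] with the spindle as an indicator. *)
Lemma spindle_transform_box r a b : 0 <= r ->
  spindle_transform F r a b = \int[box_measure]_(z in box)
    (weight (rotU a *m rotV b) z * (z.2 <= spindle_radius r z.1.2)%R%:R).
Proof.
move=> r0; set h := rotU a *m rotV b.
pose X z := weight h z * (z.2 <= spindle_radius r z.1.2)%R%:R.
have bX : bm X by exact: bm_spindle_integrand.
have lT : (lam Theta < +oo)%E by exact: itv_lty.
have lP : (lam Phi < +oo)%E by exact: itv_lty.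
have lR : (lam Rho < +oo)%E by exact: itv_lty.
rewrite -(bm_fubini1 (m1 := angle_measure) (m2 := lam) mA mR (angles_lty R) lR bX).
have bI := bm_partial_integral (m1 := angle_measure) (m2 := lam)
  mA mR (angles_lty R) lR bX.
rewrite -(bm_fubini1 (m1 := lam) (m2 := lam) mT mP lT lP bI).
apply: eq_Rintegral => t _; apply: eq_Rintegral => p _.
rewrite [LHS]Rintegral_mkcond [RHS]Rintegral_mkcond; apply: eq_Rintegral => rho _.
rewrite !patchE !mem_setE !in_itv /X /weight /box_point.
rewrite -[polar_form _ _ _ _]/(F (h *m spherical rho t p)) -[spherical _ _ _]/(spherical rho t p).
rewrite [(_, _, _).2]/= [(_, _, _).1]/= [(_, _).2]/=.
rewrite /=; have [rho0|rho0] := leP 0 rho; last by [].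
have [re|re] := leP rho e.
  by rewrite /=; case: (rho <= _); rewrite ?mulr1 ?mulr0.
rewrite /= F_out ?mulr0 ?if_same//.
by rewrite enormE sqn_rot sqn_spherical sqrtr_sqr ger0_norm.
Qed.

End box.

(** * Vanishing of the moments *)

Section moments.
Variables (R : realType) (e : R).
Hypotheses (e0 : 0 < e) (e1 : e < 1).
Local Notation lam := (@lebesgue_measure R).
Local Notation angle_measure := (sfprod lam lam).
Local Notation box_measure := (sfprod angle_measure lam).
Local Notation box := (box e).
Local Notation bm := (bounded_mfun box).

Lemma eq_bm (f g : R * R * R -> R) : (forall z, box z -> f z = g z) -> bm f -> bm g.
Proof.
move=> fg [mf [M fM]]; split; last by exists M => z Dz; rewrite -fg// fM.
by apply: (eq_measurable_fun _ _ mf) => z /set_mem Dz; rewrite fg.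
Qed.

(** The map that takes spindles to cylinders. *)
Definition stretch (x : 'cV[R]_3) : 'cV[R]_3 := (1 - sqn x)^-1 *: x.

(** The factor is singular at radius [1], but on the box it agrees with the
    continuous function obtained by cutting the denominator off at [1 - e ^+ 2]. *)
Lemma bm_stretch_factor : bm (fun z => (1 - z.2 ^+ 2)^-1).
Proof.
pose f (s : R) := (Num.max (1 - s ^+ 2) (1 - e ^+ 2))^-1.
apply: (@eq_bm (fun z => f z.2)) => [z [_ /=]|].
  rewrite in_itv/= /f => /andP[z0 ze]; congr _^-1.
  by apply/max_idPl; rewrite lerD2l lerN2 lerXn2r ?nnegrE// ltW.
apply: bm_radial => s; apply: cvgV.
  have e2 : 0 < 1 - e ^+ 2 by rewrite subr_gt0 expr2 mulr_ilt1// ltW.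
  by rewrite gt_eqF// lt_max e2 orbT.
apply: (@continuous_max _ _ (fun x : R => 1 - x ^+ 2) (cst (1 - e ^+ 2)) s);
  last exact: cst_continuous.
apply: cvgB; first exact: cvg_cst.
exact: exprn_continuous.
Qed.

Lemma bm_stretch i : bm (fun z => stretch (box_point z) i 0).
Proof.
under eq_fun do rewrite mxE sqn_spherical.
by apply: bmM; [exact: bm_stretch_factor|exact: bm_box_point].
Qed.

Variable F : 'cV[R]_3 -> R.
Hypothesis dF : continuously_differentiable F.

Let cF : continuous F. Proof. by have [g []] := dF. Qed.

Let weight B z : R := z.2 ^+ 2 * sin z.1.2 * F (B *m box_point z).

Hypothesis transform0 : forall r a b,
  0 <= r -> 0 <= a <= 2 * pi -> 0 <= b <= pi ->
  \int[box_measure]_(z in box) (z.2 ^+ 2 * sin z.1.2 * F (rotU a *m rotV b *m box_point z)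
    * (z.2 <= spindle_radius r z.1.2)%R%:R) = 0.

(** The distance from [stretch (box_point z)] to the polar axis. *)
Let sigma (z : R * R * R) : R := (1 - z.2 ^+ 2)^-1 * z.2 * sin z.1.2.

Let bm_sigma : bm sigma.
Proof.
apply: bmM; last exact: bm_sin_phi.
by apply: bmM; [exact: bm_stretch_factor|exact: bm_rho].
Qed.

Lemma axial_moments a b m : 0 <= a <= 2 * pi -> 0 <= b <= pi ->
  \int[box_measure]_(z in box) (weight (rotU a *m rotV b) z * sigma z ^+ m) = 0.
Proof.
move=> a2pi bpi.
apply: (sublevel_moments (mu := box_measure) (@measurable_box R e) (box_lty e) bm_sigma).
- move=> z [[_ /= z12] z2]; move: z12 z2; rewrite /= !in_itv/= => z12 /andP[z0 z1].
  rewrite /sigma mulr_ge0 ?sin_ge0_pi// mulr_ge0// invr_ge0.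
  by have zlt := ltW (le_lt_trans z1 e1); rewrite subr_ge0 expr2 mulr_ile1.
- exact: bm_weight.
- move=> t t0; rewrite -(transform0 (r := (2 * t)^-1) _ a2pi bpi); last first.
    by rewrite invr_ge0 mulr_ge0// ltW.
  apply: eq_Rintegral => z /set_mem [[_ /=]]; rewrite !in_itv/= => z12 /andP[z0 z1].
  congr (_ * _%:R); rewrite le_spindle_radius ?sin_ge0_pi//; last exact: le_lt_trans e1.
  by rewrite /sigma [_^-1 * _]mulrC.
Qed.

(** Slice by radius.  On each sphere the integrand is the same function of the
    direction up to a factor, and the rotation that takes the polar axis to [w]
    may be inserted; it turns [cross2 w] into a multiple of [sigma ^+ 2]. *)
Lemma transversal_moments w k :
  \int[box_measure]_(z in box)
    (z.2 ^+ 2 * sin z.1.2 * F (box_point z) * cross2 w (stretch (box_point z)) ^+ k) = 0.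
Proof.
have [a [b [a2pi bpi wE]]] := spherical_coordinates w.
set h := rotU a *m rotV b.
have {}wE : w = h *m vec3 0 0 (enorm w) by rewrite rot_axis.
pose G x := F x * cross2 w x ^+ k.
have [g C1G] : continuously_differentiable G.
  by apply: cdiffM => //; apply: cdiffX; exact: cdiff_cross2.
have cG : continuous G by have [] := C1G.
pose c (s : R) := s ^+ 2 * ((1 - s ^+ 2)^-1) ^+ 2 ^+ k.
have bc : bm (fun z => c z.2).
  by apply: bmM; [apply: bmX; exact: bm_rho|do 2!apply: bmX; exact: bm_stretch_factor].
have mA := @measurable_angles R.
have mR : measurable (`[0, e]%classic : set R) by [].
have lA := angles_lty R.
have lR := itv_lty 0 e.
have slice B : \int[box_measure]_(z in box) (c z.2 * (sin z.1.2 * G (B *m box_point z))) =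
    \int[lam]_(s in `[0, e]) (c s * \int[angle_measure]_(z in @angles R)
      (sin z.2 * G (B *m spherical s z.1 z.2))).
  have b2 : bm (fun z => sin z.1.2 * G (B *m box_point z)).
    by apply: bmM; [exact: bm_sin_phi|exact: bm_comp_box_point].
  have b1 : bm (fun z => c z.2 * (sin z.1.2 * G (B *m box_point z))) by exact: bmM.
  rewrite -(bm_fubini2 (m1 := angle_measure) (m2 := lam) mA mR lA lR b1).
  apply: eq_Rintegral => s /set_mem sR /=.
  rewrite (bm_integralZ (mu := angle_measure) mA lA)//.
  exact: (bm_sectionr mA mR b2 sR).
transitivity (\int[box_measure]_(z in box) (c z.2 * (sin z.1.2 * G (1%:M *m box_point z)))).
  apply: eq_Rintegral => z _.
  by rewrite mul1mx /stretch cross2Zr sqn_spherical exprMn /G /c; ring.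
rewrite slice.
transitivity (\int[box_measure]_(z in box) (c z.2 * (sin z.1.2 * G (h *m box_point z)))).
  rewrite slice; apply: eq_Rintegral => s _; congr (_ * _).
  under eq_Rintegral do rewrite mul1mx.
  by rewrite (sphere_integral_rot C1G).
transitivity (\int[box_measure]_(z in box)
    ((enorm w ^+ 2) ^+ k * (weight h z * sigma z ^+ (2 * k)))).
  apply: eq_Rintegral => z _.
  rewrite /G {1}wE cross2_rot cross2_axis_spherical /c /weight /sigma.
  by rewrite [in RHS]exprM !exprMn; ring.
rewrite (bm_integralZ (mu := box_measure) (@measurable_box R e) (box_lty e)).
  by rewrite axial_moments ?mulr0.
by apply: bmM; [exact: bm_weight|exact: bmX].
Qed.

Lemma all_moments w m k :
  \int[box_measure]_(z in box) (z.2 ^+ 2 * sin z.1.2 * F (box_point z) *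
    (sqn (stretch (box_point z)) ^+ m * cross2 w (stretch (box_point z)) ^+ k)) = 0.
Proof.
apply: (transversal_moments_sqn (mu := box_measure) (@measurable_box R e) (box_lty e)).
- exact: bm_stretch.
- by have := bm_weight e cF 1%:M; under eq_fun do rewrite mul1mx.
- by move=> {}k {}w; exact: transversal_moments.
Qed.

End moments.

(** * Separation of the points of the half ball *)

Section separation.
Variable R : realType.
Implicit Types (x y w : 'cV[R]_3).

Definition gap y0 x : R := (sqn (stretch x) - sqn y0) ^+ 2 + cross2 y0 (stretch x).

(** The numerator of [gap]: a polynomial, hence continuous everywhere. *)
Definition gap_num y0 x : R :=
  (sqn x - sqn y0 * (1 - sqn x) ^+ 2) ^+ 2 + (1 - sqn x) ^+ 2 * cross2 y0 x.

Lemma gap_ge0 y0 x : 0 <= gap y0 x.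
Proof. by rewrite addr_ge0 ?sqr_ge0 ?cross2_ge0. Qed.

Lemma gapxx x : gap (stretch x) x = 0.
Proof. by rewrite /gap /cross2 -sqn_dotp; ring. Qed.

Lemma gapE y0 x : 0 < 1 - sqn x -> gap y0 x * (1 - sqn x) ^+ 4 = gap_num y0 x.
Proof.
move=> u0; rewrite /gap /gap_num /stretch sqnZ cross2Zr.
have un0 : 1 - sqn x != 0 by rewrite gt_eqF.
by field.
Qed.

Lemma gap_num_le y0 x : 0 < 1 - sqn x -> gap_num y0 x <= gap y0 x.
Proof.
move=> u0; have u1 : 1 - sqn x <= 1 by rewrite gerBl sqn_ge0.
by rewrite -gapE// ler_piMr ?gap_ge0// exprn_ile1// ltW.
Qed.

(** Equal stretched norms force equal norms, and equality in the Cauchy-Schwarz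
    inequality then gives [x = x0] or [x = - x0]; the half space excludes the
    second case. *)
Lemma gap_num_separates x0 x : 0 < 1 - sqn x0 -> 0 < 1 - sqn x ->
  0 < x0 ord_max 0 -> 0 < x ord_max 0 -> gap_num (stretch x0) x = 0 -> x = x0.
Proof.
move=> u0 u h0 h /eqP.
rewrite paddr_eq0 ?sqr_ge0 ?mulr_ge0 ?cross2_ge0 ?(ltW u)//.
rewrite sqrf_eq0 mulf_eq0 expf_eq0 (gt_eqF u) andbF /= /stretch sqnZ cross2Zl.
have u0n0 : 1 - sqn x0 != 0 by rewrite gt_eqF.
rewrite mulf_eq0 expf_eq0 invr_eq0 (negbTE u0n0) andbF /=.
move=> /andP[/eqP E1 /eqP E2].
set a := sqn x in u E1 *; set b := sqn x0 in u0 u0n0 E1 *.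
have a0 : 0 <= a by exact: sqn_ge0.
have b0 : 0 <= b by exact: sqn_ge0.
have ab : a = b.
  have : a * (1 - b) ^+ 2 - b * (1 - a) ^+ 2 = 0.
    transitivity ((a - (1 - b)^-1 ^+ 2 * b * (1 - a) ^+ 2) * (1 - b) ^+ 2).
      by field.
    by rewrite E1 mul0r.
  rewrite (_ : _ - _ = (a - b) * (1 - a * b)); last by ring.
  move/eqP; rewrite mulf_eq0 => /orP[/eqP|/eqP]; first by move/eqP; rewrite subr_eq0 => /eqP.
  (* The other factor [1 - a * b] is positive. *)
  by nra.
move: E2; rewrite /cross2 -/a -/b -ab => /eqP; rewrite subr_eq0 -expr2 eqf_sqr.
move=> /orP[] /eqP E.
  apply/eqP; rewrite -subr_eq0; apply/eqP/sqn_eq0.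
  transitivity (a + b - 2 * dotp x x0); last by rewrite -ab -E; ring.
  by rewrite /a /b /sqn /dotp !sum3 !mxE; ring.
have : x + x0 = 0.
  apply/sqn_eq0; transitivity (a + b + 2 * dotp x x0); last by rewrite -ab E; ring.
  by rewrite /a /b /sqn /dotp !sum3 !mxE; ring.
move/colP/(_ ord_max); rewrite !mxE => /eqP.
by rewrite gt_eqF// addr_gt0.
Qed.

Lemma continuous_gap_num y0 : continuous (gap_num y0).
Proof.
have cs := cdiff_sqn R.
have c1 : continuously_differentiable (fun x : 'cV[R]_3 => (1 - sqn x) ^+ 2).
  rewrite (_ : (fun _ => _) = fun x => (1 + (-1) * sqn x) ^+ 2).
    by apply: cdiffX; apply: cdiffD; [exact: cdiff_cst|apply: cdiffM => //; exact: cdiff_cst].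
  by apply/funext => x; rewrite mulN1r.
apply: cdiff_continuous; apply: cdiffD; last by apply: cdiffM => //; exact: cdiff_cross2.
rewrite (_ : (fun _ => _) = fun x => (sqn x + (- sqn y0) * (1 - sqn x) ^+ 2) ^+ 2).
  by apply: cdiffX; apply: cdiffD => //; apply: cdiffM => //; exact: cdiff_cst.
by apply/funext => x; rewrite mulNr.
Qed.

Lemma continuous_gap y0 x : 0 < 1 - sqn x -> {for x, continuous (gap y0)}.
Proof.
move=> u0.
have cs := cdiff_continuous (cdiff_sqn R).
have cu : {for x, continuous (fun x => (1 - sqn x)^-1 ^+ 2)}.
  apply: (@continuous_comp _ _ _ (fun x => (1 - sqn x)^-1) (fun s => s ^+ 2)).
    have un0 : 1 - sqn x != 0 by rewrite gt_eqF.
    have c1 : (fun y => 1 - sqn y) @ nbhs x --> 1 - sqn x.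
      by apply: cvgB; [exact: cvg_cst|exact: cs].
    exact: (cvgV un0 c1).
  exact: exprn_continuous.
rewrite (_ : gap y0 = fun x => ((1 - sqn x)^-1 ^+ 2 * sqn x - sqn y0) ^+ 2 +
    (1 - sqn x)^-1 ^+ 2 * cross2 y0 x).
  pose f y := (1 - sqn y)^-1 ^+ 2 * sqn y - sqn y0.
  have cf : {for x, continuous f} by exact: (cvgB (cvgM cu (cs x)) (cvg_cst _)).
  have cf2 : {for x, continuous (fun y => f y ^+ 2)}.
    by apply: (@continuous_comp _ _ _ f (fun s => s ^+ 2)) => //; exact: exprn_continuous.
  exact: (cvgD cf2 (cvgM cu (cdiff_continuous (cdiff_cross2 y0) (x:=x)))).
by apply/funext => y; rewrite /gap sqnZ cross2Zr.
Qed.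

End separation.

(** * Uniqueness *)

Section uniqueness.
Variables (R : realType) (e : R).
Hypotheses (e0 : 0 < e) (e1 : e < 1).
Local Notation lam := (@lebesgue_measure R).
Local Notation angle_measure := (sfprod lam lam).
Local Notation box_measure := (sfprod angle_measure lam).
Local Notation box := (box e).
Local Notation bm := (bounded_mfun box).

(** Interior as a set of triples: the points on the polar axis have no interior
    coordinates, although they may lie inside the ball. *)
Definition box_interior : set (R * R * R) :=
  [set z | [/\ 0 < z.1.1 < 2 * pi, 0 < z.1.2 < pi & 0 < z.2 < e]].

Lemma box_interior_subset : box_interior `<=` box.
Proof.
move=> z [/andP[a b] /andP[c d] /andP[f g]].
by split; [split|]; rewrite /= in_itv/= !ltW.
Qed.

Lemma continuous_box_point : continuous (@box_point R).
Proof.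
move=> z.
have c1 : (y.1.1 @[y --> z] --> z.1.1) by apply: cvg_comp cvg_fst cvg_fst.
have c2 : (y.1.2 @[y --> z] --> z.1.2) by apply: cvg_comp cvg_fst cvg_snd.
have c3 : (y.2 @[y --> z] --> z.2) by exact: cvg_snd.
have st := cvg_comp _ _ c1 (@continuous_sin R z.1.1).
have ct := cvg_comp _ _ c1 (@continuous_cos R z.1.1).
have sp := cvg_comp _ _ c2 (@continuous_sin R z.1.2).
have cp := cvg_comp _ _ c2 (@continuous_cos R z.1.2).
apply: (@cV_cvg _ _ (nbhs z) _ (@box_point R)); elim/ord3P; rewrite !mxE;
  under eq_fun do rewrite mxE /=.
- exact: (cvgM (cvgM c3 sp) ct).
- exact: (cvgM (cvgM c3 sp) st).
- exact: (cvgM c3 cp).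
Qed.

Lemma open_box_interior (z : R * R * R) : box_interior z -> nbhs z box_interior.
Proof.
move=> [/andP[a b] /andP[c d] /andP[f g]].
have c1 : (y.1.1 @[y --> z] --> z.1.1) by apply: cvg_comp cvg_fst cvg_fst.
have c2 : (y.1.2 @[y --> z] --> z.1.2) by apply: cvg_comp cvg_fst cvg_snd.
have c3 : (y.2 @[y --> z] --> z.2) by exact: cvg_snd.
near=> y; split; apply/andP; split; near: y.
- exact: cvgr_gt c1 _ a. 
- exact: cvgr_lt c1 _ b. 
- exact: cvgr_gt c2 _ c. 
- exact: cvgr_lt c2 _ d. 
- exact: cvgr_gt c3 _ f. 
- exact: cvgr_lt c3 _ g. 
Unshelve. all: by end_near. Qed.

Lemma nbhs_positive_measure (z : R * R * R) (P : set (R * R * R)) : nbhs z P ->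
  exists A, [/\ measurable A, A `<=` P & (0 < box_measure A)%E].
Proof.
move=> /nbhs_ballP[d /= d0 dP].
exists ((ball z.1.1 d `*` ball z.1.2 d) `*` ball z.2 d); split.
- by apply: measurableX; [apply: measurableX|]; exact: measurable_ball.
- by move=> y [[y1 y2] y3]; apply: dP; split; [split|].
have md (s : R) : measurable (ball s d) by exact: measurable_ball.
have E (s : R) : lam (ball s d) = (d *+ 2)%:E by apply: lebesgue_measure_ball; exact: ltW.
have mA := measurableX (md z.1.1) (md z.1.2).
have E1 : angle_measure (ball z.1.1 d `*` ball z.1.2 d) =
    (lam (ball z.1.1 d) * lam (ball z.1.2 d))%E.
  exact: (product_measure1E lam lam (md z.1.1) (md z.1.2)).
have E2 : box_measure ((ball z.1.1 d `*` ball z.1.2 d) `*` ball z.2 d) =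
    (angle_measure (ball z.1.1 d `*` ball z.1.2 d) * lam (ball z.2 d))%E.
  exact: (product_measure1E angle_measure lam mA (md z.2)).
by rewrite E2 E1 !E !mule_gt0// lte_fin mulrn_wgt0.
Qed.

Variables (F : 'cV[R]_3 -> R) (K : set 'cV[R]_3).
Hypotheses (cK : compact K)
  (KO : forall x, K x -> 0 < x ord_max 0 /\ enorm x < e).

Definition moments_vanish F := forall w m k,
  \int[box_measure]_(z in box) (z.2 ^+ 2 * sin z.1.2 * F (box_point z) *
    (sqn (stretch (box_point z)) ^+ m * cross2 w (stretch (box_point z)) ^+ k)) = 0.

(** [beta] bounds [gap] from below on the compact set of points of the support
    where [F] is not positive.  Hence [F] is nonnegative wherever
    [q = 1 - gap / N] exceeds [1 - beta / N], and [powers_concentrate] applies. *)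
Lemma moments_vanish_nonpos (z0 : R * R * R) : continuous F ->
  (forall x, F x != 0 -> K x) -> moments_vanish F ->
  box_interior z0 -> F (box_point z0) <= 0.
Proof.
move=> cF FK mF z0i; rewrite leNgt; apply/negP => F0.
set x0 := box_point z0 in F0.
have Ku x : K x -> 0 < 1 - sqn x.
  move=> /KO[_ xe]; rewrite subr_gt0 -enorm_sqr expr2.
  by rewrite mulr_ilt1 ?sqrtr_ge0// (lt_trans xe).
have Kx0 : K x0 by apply: FK; rewrite gt_eqF.
pose y0 := stretch x0.
have [beta beta0 betaP] : exists2 beta : R, 0 < beta &
    forall x, K x -> F x <= 0 -> beta <= gap y0 x.
  pose K' := K `&` F @^-1` [set s | s <= 0].
  have cK' : compact K'.
    apply: (compact_closedI cK).
    exact: (closed_comp (fun x _ => cF x) (@closed_le R 0)).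
  have [[x1 K1]|K0] := pselect (K' !=set0); last first.
    by exists 1 => // x Kx Fx; exfalso; apply: K0; exists x.
  have [c /set_mem[Kc Fc] cmin] := compact_EVT_min (ex_intro _ x1 K1) cK'
    (continuous_subspaceT (@continuous_gap_num R y0)).
  exists (gap_num y0 c).
    have : 0 <= gap_num y0 c by rewrite -gapE ?Ku// mulr_ge0 ?gap_ge0// exprn_ge0// ltW// Ku.
    rewrite le_eqVlt => /predU1P[/esym G0|//].
    have [h0 _] := KO Kx0; have [hc _] := KO Kc.
    have E := gap_num_separates (Ku _ Kx0) (Ku _ Kc) h0 hc G0.
    by move: Fc; rewrite /= E leNgt F0.
  move=> x Kx Fx; apply: le_trans (gap_num_le _ (Ku _ Kx)).
  by apply: cmin; exact/mem_set.
pose D z := gap y0 (box_point z).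
have mB := @measurable_box R e.
have lB := box_lty e.
have bS : bm (fun z => sqn (stretch (box_point z))) by apply: bm_sqn => i; exact: bm_stretch.
have bC : bm (fun z => cross2 y0 (stretch (box_point z))).
  by apply: bm_cross2 => i; exact: bm_stretch.
have bD : bm D by apply: bmD => //; apply: bmX; apply: bmB => //; exact: bm_cst.
have [_ [M DM]] := bD.
pose N := `|M| + 1.
have N0 : 0 < N by rewrite ltr_pwDr.
have DN z : box z -> D z <= N.
  move=> Bz; rewrite (le_trans (ler_norm _))// (le_trans (DM _ Bz))//.
  by rewrite (le_trans (ler_norm _))// lerDl.
pose q z := 1 - D z / N.
pose g z := z.2 ^+ 2 * sin z.1.2 * F (box_point z).
(* The minimum with [N] keeps the level [1 - beta' / N] nonnegative. *)
pose beta' := Num.min beta N.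
have beta'0 : 0 < beta' by rewrite lt_min beta0.
have bg : bm g by have := bm_weight e cF 1%:M; under eq_fun do rewrite mul1mx.
have bq : bm q by apply: bmB; [exact: bm_cst|apply: bmM => //; exact: bm_cst].
(* Multiplication by [q] preserves orthogonality to all [sqn ^+ m * cross2 ^+ k],
   because [q] is a polynomial in [sqn] and [cross2]. *)
have gq n : \int[box_measure]_(z in box) (g z * q z ^+ n) = 0.
  suff H m k : \int[box_measure]_(z in box) (g z * q z ^+ n *
      (sqn (stretch (box_point z)) ^+ m * cross2 y0 (stretch (box_point z)) ^+ k)) = 0.
    by rewrite -(H 0 0); apply: eq_Rintegral => z _; rewrite !expr0 !mulr1.
  elim: n m k => [|n IH] m k.
    by under eq_Rintegral do rewrite expr0 mulr1; exact: mF.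
  pose T m k z := g z * q z ^+ n *
      (sqn (stretch (box_point z)) ^+ m * cross2 y0 (stretch (box_point z)) ^+ k).
  have bT m' k' : bm (T m' k') by apply: bmM; [apply: bmM => //; exact: bmX|apply: bmM; exact: bmX].
  have bcT c m' k' : bm (fun z => c * T m' k' z) by apply: bmM => //; exact: bm_cst.
  have TZ c m' k' : \int[box_measure]_(z in box) (c * T m' k' z) = 0.
    have E : \int[box_measure]_(z in box) T m' k' z = 0 by exact: IH.
    by rewrite (bm_integralZ (mu := box_measure) mB lB c (bT m' k')) E mulr0.
  pose s := sqn y0.
  transitivity (\int[box_measure]_(z in box) ((1 - s ^+ 2 / N) * T m k z +
      (2 * s / N) * T m.+1 k z + (- N^-1) * T m.+2 k z + (- N^-1) * T m k.+1 z)).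
    apply: eq_Rintegral => z _.
    by rewrite /T [in LHS]exprS !exprS {1}/q /D /gap -/s; ring.
  have b1 := bmD (bcT (1 - s ^+ 2 / N) m k) (bcT (2 * s / N) m.+1 k).
  have b2 := bmD b1 (bcT (- N^-1) m.+2 k).
  rewrite (bm_integralD (mu := box_measure) mB lB b2 (bcT _ _ _)).
  rewrite (bm_integralD (mu := box_measure) mB lB b1 (bcT _ _ _)).
  by rewrite (bm_integralD (mu := box_measure) mB lB (bcT _ _ _) (bcT _ _ _)) !TZ !addr0.
have g0 : 0 < g z0.
  case: z0i => [_ p0 /andP[r0 _]].
  by rewrite /g mulr_gt0// mulr_gt0 ?exprn_gt0// sin_gt0_pi.
have cg : {for z0, continuous g}.
  have c2 : (y.1.2 @[y --> z0] --> z0.1.2) by apply: cvg_comp cvg_fst cvg_snd.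
  have c3 : (y.2 @[y --> z0] --> z0.2) by exact: cvg_snd.
  have sp := cvg_comp _ _ c2 (@continuous_sin R z0.1.2).
  have r2 := cvg_comp _ _ c3 (@exprn_continuous _ 2 z0.2).
  have cFp := cvg_comp _ _ (@continuous_box_point z0) (cF x0).
  exact: (cvgM (cvgM r2 sp) cFp).
have cD : {for z0, continuous D}.
  exact: (cvg_comp _ _ (@continuous_box_point z0) (continuous_gap (y0 := y0) (Ku _ Kx0))).
have D0 : D z0 = 0 by rewrite /D gapxx.
have [A [mA AP muA]] : exists A, [/\ measurable A,
    A `<=` [set z | [/\ box_interior z, g z0 / 2 < g z & D z < beta' / 2]] &
    (0 < box_measure A)%E].
  apply: (@nbhs_positive_measure z0); near=> z; split; near: z.
  - exact: open_box_interior.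
  - by apply: cvgr_gt cg _ _; rewrite ltr_pdivrMr// ltr_pMr// ltr1n.
  - by apply: cvgr_lt cD _ _; rewrite D0 divr_gt0.
apply: (powers_concentrate (mu := box_measure) (D := box) (A := A) (g := g) (q := q)
  (a := 1 - beta' / 2 / N) (b := 1 - beta' / N) (c := g z0 / 2)) => //.
- by move=> z /AP[zi _ _]; exact: box_interior_subset.
- by rewrite divr_gt0.
- by rewrite subr_ge0 ler_pdivrMr// mul1r ge_min lexx orbT.
- rewrite ltrD2l ltrN2 ltr_pM2r ?invr_gt0// ltr_pdivrMr// ltr_pMr// ltr1n//.
- by move=> z Bz; rewrite subr_ge0 ler_pdivrMr// mul1r DN.
- by move=> z /AP[_ gz _]; exact: ltW.
- by move=> z /AP[_ _ Dz]; rewrite lerD2l lerN2 ler_pM2r ?invr_gt0// ltW.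
- move=> z [[_ pz] rz]; rewrite ltrD2l ltrN2 ltr_pM2r ?invr_gt0// lt_min => /andP[Db _].
  have s0 : 0 <= z.2 ^+ 2 * sin z.1.2.
    by rewrite mulr_ge0 ?sqr_ge0// sin_ge0_pi//; move: pz; rewrite /= in_itv.
  have [F0'|Fneg] := leP 0 (F (box_point z)); first exact: mulr_ge0.
  have Kz : K (box_point z) by apply: FK; rewrite lt_eqF.
  by have := betaP _ Kz (ltW Fneg); rewrite leNgt Db.
Unshelve. all: by end_near. Qed.

End uniqueness.

Section vanishing.
Variables (R : realType) (e : R).
Hypotheses (e0 : 0 < e) (e1 : e < 1).

(** A step towards the midpoint of the interval. *)
Let interior_dense (l r t d : R) : l < r -> l <= t <= r -> 0 < d ->
  exists2 s, l < s < r & `|t - s| < d.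
Proof.
move=> lr /andP[lt_ tr] d0; have [tm|mt] := leP t ((l + r) / 2).
  exists (t + Num.min ((r - l) / 4) (d / 2)); last first.
    rewrite opprD addNKr normrN ger0_norm.
      by rewrite gt_min [X in _ || X](_ : _ = true) ?orbT//; lra.
    by rewrite le_min; lra.
  have : 0 < Num.min ((r - l) / 4) (d / 2) by rewrite lt_min; lra.
  have : Num.min ((r - l) / 4) (d / 2) <= (r - l) / 4 by rewrite ge_min lexx.
  by move=> *; lra.
exists (t - Num.min ((r - l) / 4) (d / 2)); last first.
  rewrite opprB addrC subrK ger0_norm.
    by rewrite gt_min [X in _ || X](_ : _ = true) ?orbT//; lra.
  by rewrite le_min; lra.
have : 0 < Num.min ((r - l) / 4) (d / 2) by rewrite lt_min; lra.
have : Num.min ((r - l) / 4) (d / 2) <= (r - l) / 4 by rewrite ge_min lexx.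
by move=> *; lra.
Qed.

Variables (F : 'cV[R]_3 -> R) (K : set 'cV[R]_3).
Hypotheses (cK : compact K)
  (KO : forall x, K x -> 0 < x ord_max 0 /\ enorm x < e).

(** A point where [F] does not vanish may have boundary coordinates, for instance
    colatitude [0]; by continuity [F] is then nonzero at an interior triple too. *)
Lemma moments_vanish_eq0 : continuous F -> (forall x, F x != 0 -> K x) ->
  moments_vanish e F -> forall x, F x = 0.
Proof.
move=> cF FK mF x; apply/eqP; apply: contraT => Fx.
have Fi z : box_interior e z -> F (box_point z) = 0.
  move=> zi; apply/eqP; rewrite eq_le; apply/andP; split.
    exact: (moments_vanish_nonpos e0 e1 cK KO).
  rewrite -oppr_le0.
  apply: (moments_vanish_nonpos e0 e1 cK KO (F := fun x => - F x)) => //.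
  - by move=> y; exact: (cvgN (cF y)).
  - by move=> y; rewrite oppr_eq0; exact: FK.
  - move=> w m k; under eq_Rintegral do rewrite mulrN mulNr -mulN1r.
    rewrite (bm_integralZ (mu := sfprod (sfprod lebesgue_measure lebesgue_measure)
      lebesgue_measure) (@measurable_box R e) (box_lty e)).
      by rewrite mF mulr0.
    apply: bmM; first by have := bm_weight e cF 1%:M; under eq_fun do rewrite mul1mx.
    have bs i : bounded_mfun (box e) (fun z => stretch (box_point z) i 0) by exact: bm_stretch.
    by apply: bmM; apply: bmX; [exact: bm_sqn|exact: bm_cross2].
have [t [p [t2pi ppi xE]]] := spherical_coordinates x.
have [_ xe] := KO (FK _ Fx).
have : nbhs (t, p, enorm x) [set z | F (box_point z) != 0].
  have c : F (box_point z) @[z --> (t, p, enorm x)] --> F (box_point (t, p, enorm x)).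
    exact: (cvg_comp _ _ (@continuous_box_point R _) (cF _)).
  by apply: (cvgr_neq0 _ c); rewrite /box_point /= -xE.
move=> /nbhs_ballP[d /= d0 dF].
have [t' ti td] := interior_dense (mulr_gt0 (ltr0n R 2) (pi_gt0 R)) t2pi d0.
have [p' pi' pd] := interior_dense (pi_gt0 R) ppi d0.
have xr : 0 <= enorm x <= e by rewrite sqrtr_ge0 ltW.
have [r' ri rd] := interior_dense e0 xr d0.
have /= := dF (t', p', r').
rewrite Fi ?eqxx//= => H; apply: H.
by split; [split|].
Qed.

End vanishing.

Theorem corollary2 (R : realType) (eps1 eps2 : R) (f1 f2 : 'cV[R]_3 -> R)
  (eps1_gt0 : 0 < eps1) (eps12 : eps1 < eps2) (eps2_lt1 : eps2 < 1)
  (f1_test : C0infty (hollow_ball eps1 eps2 `&` half_space) f1)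
  (f2_test : C0infty (hollow_ball eps1 eps2 `&` half_space) f2)
  (eq_transform : forall r alpha beta : R,
     0 <= r -> 0 <= alpha <= 2 * pi -> 0 <= beta <= pi ->
     spindle_transform f1 r alpha beta = spindle_transform f2 r alpha beta) :
  forall x : 'cV[R]_3, 0 < enorm x < 1 -> f1 x = f2 x.
Proof.
move=> x _.
have e0 : 0 < eps2 := lt_trans eps1_gt0 eps12.
have [s1 c1 o1] := f1_test; have [s2 c2 o2] := f2_test.
have d1 := smooth_cdiff s1; have d2 := smooth_cdiff s2.
have supp (f : 'cV[R]_3 -> R) y : f y != 0 -> support_closure f y.
  by move=> fy; exact: subset_closure.
have out (f : 'cV[R]_3 -> R) : support_closure f `<=` hollow_ball eps1 eps2 `&` half_space ->
    forall y, eps2 < enorm y -> f y = 0.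
  move=> of_ y ey; apply/eqP; apply: contraT => /supp/of_[/andP[_ ey'] _].
  by move: (lt_trans ey ey'); rewrite ltxx.
pose F y := f1 y - f2 y.
have dF : continuously_differentiable F.
  rewrite (_ : F = fun y => f1 y + (-1) * f2 y).
    by apply: cdiffD => //; apply: cdiffM => //; exact: cdiff_cst.
  by apply/funext => y; rewrite mulN1r.
apply/eqP; rewrite -subr_eq0 -/(F x); apply/eqP.
apply: (@moments_vanish_eq0 R eps2 e0 eps2_lt1 F (support_closure f1 `|` support_closure f2)).
- rewrite (_ : _ `|` _ = \big[setU/set0]_(f <- [:: f1; f2]) support_closure f).
    by rewrite big_seq; apply: bigsetU_compact => f; rewrite !inE => /orP[]/eqP->.
  by rewrite !big_cons big_nil setU0.
- by move=> y [/o1|/o2] [/andP[_ ?] ?].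
- exact: cdiff_continuous.
- move=> y; rewrite /F => Fy.
  have [f1y|f1y] := eqVneq (f1 y) 0; last by left; exact: supp.
  by right; apply: supp; move: Fy; rewrite f1y sub0r oppr_eq0.
move=> w m k; apply: all_moments => // r a b r0 a2pi bpi.
have cf1 := cdiff_continuous d1; have cf2 := cdiff_continuous d2.
have := eq_transform r a b r0 a2pi bpi.
rewrite (spindle_transform_box cf1 (out _ o1))// (spindle_transform_box cf2 (out _ o2))//.
move/eqP; rewrite -subr_eq0 => /eqP E; rewrite -[RHS]E.
rewrite -(bm_integralB (mu := sfprod (sfprod lebesgue_measure lebesgue_measure)
  lebesgue_measure) (@measurable_box R eps2) (box_lty eps2)); first last.
- exact: bm_spindle_integrand.
- exact: bm_spindle_integrand.
by apply: eq_Rintegral => z _; rewrite /F; ring.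
Qed.
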